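(* Let $m,n$ be nonnegative integers and let $M$, $N$, and $L$ be weak Bruhat interval modules of $H_m(0)$, $H_n(0)$, and $H_{m+n}(0)$, respectively. Then there are the following isomorphisms of modules. (A1) $\phi[M\boxtimes N]\cong\phi[N]\boxtimes\phi[M]$. (A2) $\theta[M\boxtimes N]\cong\theta[M]\boxtimes\theta[N]$. (A3) $\chi[M\boxtimes N]\cong\chi[N]\boxtimes\chi[M]$. (B1) $\phi\big[L\downarrow^{H_{m+n}(0)}_{H_n(0)\otimes H_m(0)}\big]\cong\phi[L]\downarrow^{H_{m+n}(0)}_{H_m(0)\otimes H_n(0)}$. (B2) $\theta\big[L\downarrow^{H_{m+n}(0)}_{H_m(0)\otimes H_n(0)}\big]\cong\theta[L]\downarrow^{H_{m+n}(0)}_{H_m(0)\otimes H_n(0)}$. (B3) $\chi\big[L\downarrow^{H_{m+n}(0)}_{H_m(0)\otimes H_n(0)}\big]\cong\chi[L]\downarrow^{H_{m+n}(0)}_{H_m(0)\otimes H_n(0)}$.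
   Context: Permutations are composed as functions; $s_i=(i,i+1)$; $\ell$ is the Coxeter length; $\mathrm{Des}_L(\sigma)=\{i\mid \ell(s_i\sigma)<\ell(\sigma)\}$. Left weak Bruhat order: $\sigma\preceq_L\rho$ iff $\rho=\gamma\sigma$ with $\ell(\rho)=\ell(\gamma)+\ell(\sigma)$ for some $\gamma$; $[\sigma,\rho]_L=\{\gamma\mid\sigma\preceq_L\gamma\preceq_L\rho\}$. $H_k(0)$ is the unital $\mathbb{C}$-algebra generated by $\pi_1,\dots,\pi_{k-1}$ with relations $\pi_i^2=\pi_i$, $\pi_i\pi_{i+1}\pi_i=\pi_{i+1}\pi_i\pi_{i+1}$, $\pi_i\pi_j=\pi_j\pi_i$ for $|i-j|\ge2$; $\overline{\pi}_i:=\pi_i-1$. $H_a(0)\otimes H_b(0)$ is viewed as the subalgebra of $H_{a+b}(0)$ generated by $\{\pi_i\mid i\in[a+b-1]\setminus\{a\}\}$. $\downarrow$ is restriction, $\uparrow$ is induction ($M\uparrow_B^A=A\otimes_BM$), and $M\boxtimes N:=(M\otimes N)\uparrow^{H_{a+b}(0)}_{H_a(0)\otimes H_b(0)}$ for an $H_a(0)$-module $M$ and an $H_b(0)$-module $N$. A weak Bruhat interval module of $H_k(0)$ is a module $\mathsf{B}(\sigma,\rho)$ with $\sigma,\rho\in\mathfrak{S}_k$: it has basis $[\sigma,\rho]_L$ and action $\pi_i\cdot\gamma=\gamma$ if $i\in\mathrm{Des}_L(\gamma)$; $0$ if $i\notin\mathrm{Des}_L(\gamma)$ and $s_i\gamma\notin[\sigma,\rho]_L$;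 $s_i\gamma$ if $i\notin\mathrm{Des}_L(\gamma)$ and $s_i\gamma\in[\sigma,\rho]_L$. For each $k$, $\phi,\theta:H_k(0)\to H_k(0)$ are the algebra involutions with $\phi(\pi_i)=\pi_{k-i}$ and $\theta(\pi_i)=-\overline{\pi}_i$, and $\chi:H_k(0)\to H_k(0)$ is the algebra anti-involution with $\chi(\pi_i)=\pi_i$. For an algebra isomorphism $\mu:B\to A$ and a left $A$-module $V$, $\mu[V]$ is the $B$-module on the space $V$ with action $b\cdot_\mu v=\mu(b)\cdot v$. For an algebra anti-isomorphism $\nu:B\to A$, $\nu[V]$ is the $B$-module on the dual space $V^*$ with action $(b\cdot^\nu\delta)(v)=\delta(\nu(b)\cdot v)$. On modules over the subalgebras $H_a(0)\otimes H_b(0)$ of $H_{m+n}(0)$, the twist by $\phi$, $\theta$, $\chi$ means the twist by the corresponding restriction of the (anti-)involution of $H_{m+n}(0)$; in particular $\phi$ restricts to an isomorphism $H_m(0)\otimes H_n(0)\to H_n(0)\otimes H_m(0)$, which is the one used in (B1). *)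

(* Defs.v *)
From HB Require Import structures.
From mathcomp Require Import all_boot all_order all_fingroup all_algebra.
From mathcomp Require Import zify boolp reals complex.

Set Implicit Arguments.
Unset Strict Implicit.
Unset Printing Implicit Defensive.

Import GRing.Theory.
Local Open Scope ring_scope.
Local Open Scope quotient_scope.

(******************************************************************************)
(* Symmetric groups: 'S_k permutes {0, ..., k-1}, and the index i : 'I_k.-1   *)
(* stands for i + 1 in [k-1]; thus srefl i is s_(i+1) = (i+1, i+2).           *)
(******************************************************************************)

Section Permutations.
Variable k : nat.
Implicit Types (i : 'I_k.-1) (s t g : 'S_k).

Fact ord_lo_subproof i : (i < k)%N.
Proof. by case: k i => [|n] [i lt_i] //=; apply: ltn_trans lt_i _. Qed.

Fact ord_hi_subproof i : (i.+1 < k)%N.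
Proof. by case: k i => [|n] [i lt_i]. Qed.

Definition srefl i : 'S_k :=
  tperm (Ordinal (ord_lo_subproof i)) (Ordinal (ord_hi_subproof i)).

(* The product of perm.v composes from left to right; the one used here is
   the composition of functions. *)
Definition pcomp s t : 'S_k := (t * s)%g.

Lemma pcompE s t x : pcomp s t x = s (t x).
Proof. by rewrite /pcomp permM. Qed.

Definition wordperm (w : seq 'I_k.-1) : 'S_k := foldr (pcomp \o srefl) 1%g w.

Lemma wordperm_cat v w : wordperm (v ++ w) = pcomp (wordperm v) (wordperm w).
Proof.
elim: v => [|i v IHv] /=; first by rewrite /pcomp mulg1.
by rewrite IHv /pcomp mulgA.
Qed.

Lemma wordperm_tperm (x y : 'I_k) : exists w, wordperm w = tperm x y.
Proof.
wlog lt_xy : x y / (x < y)%N => [IH|].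
  case: (ltngtP x y) => [/IH //|/IH [w Ew]|/val_inj ->].
    by exists w; rewrite Ew tpermC.
  by exists [::]; rewrite tperm1.
move Ed: (y - x.+1)%N => d; elim: d x lt_xy Ed => [|d IHd] x lt_xy Ed.
  have lt_x : (x < k.-1)%N by have := ltn_ord y; lia.
  exists [:: Ordinal lt_x]; rewrite /= /pcomp mul1g /srefl.
  by congr tperm; apply: val_inj => //=; lia.
have lt_x : (x < k.-1)%N by have := ltn_ord y; lia.
pose i := Ordinal lt_x; pose x' := Ordinal (ord_hi_subproof i).
have [||w Ew] := IHd x'; rewrite /=; try lia.
exists (i :: w ++ [:: i]); rewrite /= wordperm_cat Ew /= /pcomp mul1g.
have Exx' : srefl i = tperm x x' by rewrite /srefl; congr tperm; apply: val_inj.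
rewrite Exx' -{1}(tpermV x x') -mulgA -/(conjg _ _) tpermJ tpermR tpermD //.
  by rewrite -val_eqE /=; lia.
by rewrite -val_eqE /=; lia.
Qed.

Fact length_subproof s :
  exists n, [exists w : n.-tuple 'I_k.-1, wordperm w == s].
Proof.
suff [w <-] : exists w, wordperm w = s.
  by exists (size w); apply/existsP; exists (in_tuple w).
have [ts -> _] := prod_tpermP s.
elim: ts => [|t ts [w Ew]]; first by exists [::]; rewrite big_nil.
have [v Ev] := wordperm_tperm t.1 t.2.
by exists (w ++ v); rewrite wordperm_cat Ev Ew big_cons.
Qed.

Definition clength s : nat := ex_minn (length_subproof s).

Definition desL s : {set 'I_k.-1} :=
  [set i | (clength (pcomp (srefl i) s) < clength s)%N].

Definition leL s t : bool :=
  [exists g, (t == pcomp g s) && (clength t == clength g + clength s)%N].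

Definition intvL s t : {set 'S_k} := [set g | leL s g && leL g t].

End Permutations.

(******************************************************************************)
(* Modules over a ring A are lmodType A. When A is an F-algebra, a scalar     *)
(* c : F acts on an A-module through c%:A.                                    *)
(******************************************************************************)

Definition mod_iso (A : pzRingType) (V W : lmodType A) : Prop :=
  exists f : {linear V -> W}, bijective f.

(* The B-module on the space V with action b . v = mu(b) v. For mu an
   isomorphism this is the twist mu[V]; for mu the inclusion of a subalgebra
   it is the restriction of V. *)
Definition pullback (B A : pzRingType) (mu : {rmorphism B -> A})
  (V : lmodType A) : Type := V.

Section Pullback.
Variables (B A : pzRingType) (mu : {rmorphism B -> A}) (V : lmodType A).
Local Notation pullback := (pullback mu V).

HB.instance Definition _ := GRing.Zmodule.on pullback.

Definition pullback_scale (b : B) (v : pullback) : pullback :=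
  (mu b *: (v : V)).

Fact pullback_scaleA b c v :
  pullback_scale b (pullback_scale c v) = pullback_scale (b * c) v.
Proof. by rewrite /pullback_scale scalerA rmorphM. Qed.
Fact pullback_scale1 : left_id 1 pullback_scale.
Proof. by move=> v; rewrite /pullback_scale rmorph1 scale1r. Qed.
Fact pullback_scaleDr : right_distributive pullback_scale +%R.
Proof. by move=> b u v; rewrite /pullback_scale scalerDr. Qed.
Fact pullback_scaleDl v :
  {morph pullback_scale^~ v : b c / b + c}.
Proof. by move=> b c; rewrite /pullback_scale rmorphD scalerDl. Qed.
HB.instance Definition _ := GRing.Zmodule_isLmodule.Build B pullback
  pullback_scaleA pullback_scale1 pullback_scaleDr pullback_scaleDl.

End Pullback.

Definition scalars (F : comNzRingType) (A : algType F) : {rmorphism F -> A} :=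
  in_alg A.
Notation vspaceof V := (pullback (scalars _) V).

(* Algebra structure of the converse algebra, so that an anti-homomorphism of
   algebras B -> A is a {lrmorphism B -> A^c}. *)
Section ConverseAlgebra.
Variables (F : comNzRingType) (A : algType F).

HB.instance Definition _ :=
  GRing.Zmodule_isLmodule.Build F A^c (@scalerA _ A) (@scale1r _ A)
    (@scalerDr _ A) (fun v a b => @scalerDl _ A v a b).
Fact converse_scaleAl (c : F) (x y : A^c) : c *: (x * y) = (c *: x) * y.
Proof. exact: (@scalerAr _ A c y x). Qed.
HB.instance Definition _ :=
  GRing.Lmodule_isLalgebra.Build F A^c converse_scaleAl.
Fact converse_scaleAr (c : F) (x y : A^c) : c *: (x * y) = x * (c *: y).
Proof. exact: (@scalerAl _ A c y x). Qed.
HB.instance Definition _ :=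
  GRing.Lalgebra_isAlgebra.Build F A^c converse_scaleAr.

End ConverseAlgebra.

(* The B-module on the dual space of V with action (b . d)(v) = d(nu(b) v),
   for an anti-homomorphism nu : B -> A. *)
Record dual (F : comNzRingType) (B A : algType F) (nu : {lrmorphism B -> A^c})
    (V : lmodType A) : Type := Dual {
  dual_fun :> V -> F;
  dualP : linear (dual_fun : vspaceof V -> F^o) }.

Section Dual.
Variables (F : comNzRingType) (B A : algType F).
Variables (nu : {lrmorphism B -> A^c}) (V : lmodType A).
Local Notation dual := (dual nu V).
Local Notation Dual := (@Dual F B A nu V _).

HB.instance Definition _ := gen_eqMixin dual.
HB.instance Definition _ := gen_choiceMixin dual.

Lemma dual_ext (d e : dual) : d =1 e -> d = e.
Proof.
case: d e => [f lf] [g lg] /= /funext fg.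
by case: _ / fg lg => lg; congr Dual; apply: Prop_irrelevance.
Qed.

Lemma dualE (d : dual) (c : F) (u v : V) :
  d (c%:A *: u + v) = c * d u + d v.
Proof. exact: (dualP d). Qed.

Fact dual_add_subproof (d e : dual) :
  linear ((fun v => d v + e v) : vspaceof V -> F^o).
Proof.
by move=> c u v /=; rewrite !dualE scalerDr addrACA.
Qed.
Definition dual_add d e := Dual (dual_add_subproof d e).
Fact dual_zero_subproof : linear ((fun=> 0) : vspaceof V -> F^o).
Proof. by move=> c u v /=; rewrite scaler0 addr0. Qed.
Definition dual_zero := Dual dual_zero_subproof.
Fact dual_opp_subproof (d : dual) :
  linear ((fun v => - d v) : vspaceof V -> F^o).
Proof. by move=> c u v /=; rewrite dualE opprD scalerN. Qed.
Definition dual_opp d := Dual (dual_opp_subproof d).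

Fact dual_addA : associative dual_add.
Proof. by move=> d e f; apply: dual_ext => v /=; rewrite addrA. Qed.
Fact dual_addC : commutative dual_add.
Proof. by move=> d e; apply: dual_ext => v /=; rewrite addrC. Qed.
Fact dual_add0 : left_id dual_zero dual_add.
Proof. by move=> d; apply: dual_ext => v /=; rewrite add0r. Qed.
Fact dual_addN : left_inverse dual_zero dual_opp dual_add.
Proof. by move=> d; apply: dual_ext => v /=; rewrite addNr. Qed.
HB.instance Definition _ :=
  GRing.isZmodule.Build dual dual_addA dual_addC dual_add0 dual_addN.

Fact dual_scale_subproof (b : B) (d : dual) :
  linear ((fun v => d ((nu b : A) *: v)) : vspaceof V -> F^o).
Proof.
move=> c u v /=; rewrite -[X in d (_ *: (X + _))]/(c%:A *: (u : V)).
by rewrite scalerDr -[RHS]dualE !scalerA mulr_algl mulr_algr.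
Qed.
Definition dual_scale b d := Dual (dual_scale_subproof b d).

Lemma dual_addE (d e : dual) v : (d + e) v = d v + e v.
Proof. by []. Qed.

Lemma dualD (d : dual) (u v : V) : d (u + v) = d u + d v.
Proof. by rewrite -[u in LHS]scale1r -(scale1r 1) dualE mul1r. Qed.

Fact dual_scaleA b c d :
  dual_scale b (dual_scale c d) = dual_scale (b * c) d.
Proof. by apply: dual_ext => v /=; rewrite rmorphM scalerA. Qed.
Fact dual_scale1 : left_id 1 dual_scale.
Proof. by move=> d; apply: dual_ext => v /=; rewrite rmorph1 scale1r. Qed.
Fact dual_scaleDr : right_distributive dual_scale +%R.
Proof. by move=> b d e; apply: dual_ext. Qed.
Fact dual_scaleDl d : {morph dual_scale^~ d : b c / b + c}.
Proof.
by move=> b c; apply: dual_ext => v /=; rewrite rmorphD scalerDl dualD.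
Qed.
HB.instance Definition _ := GRing.Zmodule_isLmodule.Build B dual
  dual_scaleA dual_scale1 dual_scaleDr dual_scaleDl.

End Dual.

(******************************************************************************)
(* Balanced tensor products: tensor ract lact is the abelian group X (x)_B V  *)
(* where B acts on the right of X by ract and on the left of V by lact; it is *)
(* the quotient of the formal expressions in the pure tensors by the least    *)
(* congruence imposing the group axioms, biadditivity and balancedness.       *)
(******************************************************************************)

Section Tensor.
Variables (X V : zmodType) (B : Type) (ract : X -> B -> X) (lact : B -> V -> V).

Inductive texpr : Type :=
  TZero | TPure of X & V | TAdd of texpr & texpr | TOpp of texpr.

Inductive teq : texpr -> texpr -> Prop :=
| teq_refl s : teq s s
| teq_sym s t : teq s t -> teq t s
| teq_trans t s u : teq s t -> teq t u -> teq s u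
| teq_add s s' t t' : teq s s' -> teq t t' -> teq (TAdd s t) (TAdd s' t')
| teq_opp s s' : teq s s' -> teq (TOpp s) (TOpp s')
| teq_addA s t u : teq (TAdd s (TAdd t u)) (TAdd (TAdd s t) u)
| teq_addC s t : teq (TAdd s t) (TAdd t s)
| teq_add0 s : teq (TAdd TZero s) s
| teq_addN s : teq (TAdd (TOpp s) s) TZero
| teq_pureDl x y v : teq (TPure (x + y) v) (TAdd (TPure x v) (TPure y v))
| teq_pureDr x v w : teq (TPure x (v + w)) (TAdd (TPure x v) (TPure x w))
| teq_bal x b v : teq (TPure (ract x b) v) (TPure x (lact b v)).

Definition teqb (s t : {classic texpr}) : bool := `[< teq s t >].
Fact teqb_equiv : equiv_class_of teqb.
Proof.
split=> [s|s t|t s u]; first exact/asboolP/teq_refl.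
  by apply/asboolP/asboolP; apply: teq_sym.
by move=> /asboolP st /asboolP tu; apply/asboolP; apply: teq_trans tu.
Qed.
Canonical teqb_equivrel := EquivRelPack teqb_equiv.

Definition tensor : Type := {eq_quot teqb}.
HB.instance Definition _ := Choice.on tensor.

Definition tclass (s : texpr) : tensor :=
  \pi_({eq_quot teqb}) (s : {classic texpr}).
Definition trepr (t : tensor) : texpr :=
  generic_quotient.repr (t : {eq_quot teqb}).

Lemma tclassP s t : tclass s = tclass t <-> teq s t.
Proof. by split=> [/eqmodP/asboolP//|st]; apply/eqmodP/asboolP. Qed.

Lemma treprK : cancel trepr tclass.
Proof. exact: reprK. Qed.

Lemma trepr_class s : teq (trepr (tclass s)) s.
Proof. by apply/tclassP; rewrite treprK. Qed.

Definition tensor_zero := tclass TZero.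
Definition tensor_add s t := tclass (TAdd (trepr s) (trepr t)).
Definition tensor_opp s := tclass (TOpp (trepr s)).

Lemma tensor_addE s t : tensor_add (tclass s) (tclass t) = tclass (TAdd s t).
Proof. by apply/tclassP; apply: teq_add; apply: trepr_class. Qed.
Lemma tensor_oppE s : tensor_opp (tclass s) = tclass (TOpp s).
Proof. by apply/tclassP; apply: teq_opp; apply: trepr_class. Qed.

Fact tensor_addA : associative tensor_add.
Proof.
move=> s t u; rewrite -(treprK s) -(treprK t) -(treprK u) !tensor_addE.
exact/tclassP/teq_addA.
Qed.
Fact tensor_addC : commutative tensor_add.
Proof. by move=> s t; apply/tclassP/teq_addC. Qed.
Fact tensor_add0 : left_id tensor_zero tensor_add.
Proof.
move=> s; rewrite -(treprK s) /tensor_zero tensor_addE.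
exact/tclassP/teq_add0.
Qed.
Fact tensor_addN : left_inverse tensor_zero tensor_opp tensor_add.
Proof.
move=> s; rewrite -(treprK s) tensor_oppE tensor_addE.
exact/tclassP/teq_addN.
Qed.
HB.instance Definition _ := GRing.isZmodule.Build tensor
  tensor_addA tensor_addC tensor_add0 tensor_addN.

Definition pure (x : X) (v : V) : tensor := tclass (TPure x v).

Lemma pureDl v : {morph pure^~ v : x y / x + y}.
Proof.
move=> x y; rewrite [RHS]tensor_addE; exact/tclassP/teq_pureDl.
Qed.
Lemma pureDr x : {morph pure x : v w / v + w}.
Proof.
move=> v w; rewrite [RHS]tensor_addE; exact/tclassP/teq_pureDr.
Qed.
Lemma pure_bal x b v : pure (ract x b) v = pure x (lact b v).
Proof. exact/tclassP/teq_bal. Qed.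

Lemma tensor_elim (P : tensor -> Prop) :
  (forall x v, P (pure x v)) -> P 0 -> (forall s t, P s -> P t -> P (s + t)) ->
  (forall s, P s -> P (- s)) -> forall t, P t.
Proof.
move=> Pp P0 PD PN t; rewrite -(treprK t).
elim: (trepr t) => [|x v|r IHr s IHs|s IHs]; first exact: P0.
- exact: Pp.
- by rewrite -tensor_addE; apply: PD.
- by rewrite -tensor_oppE; apply: PN.
Qed.

Section Lift.
Variables (G : zmodType) (f : X -> V -> G).

Definition balanced : Prop :=
  [/\ forall v, {morph f^~ v : x y / x + y},
      forall x, {morph f x : v w / v + w}
    & forall x b v, f (ract x b) v = f x (lact b v)].

Fixpoint texpr_eval (s : texpr) : G :=
  match s with
  | TZero => 0
  | TPure x v => f x v
  | TAdd s t => texpr_eval s + texpr_eval t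
  | TOpp s => - texpr_eval s
  end.

Hypothesis fP : balanced.

Lemma texpr_eval_eq s t : teq s t -> texpr_eval s = texpr_eval t.
Proof.
case: fP => fDl fDr fb.
elim=> {s t} //=.
- by move=> t s u _ -> _ ->.
- by move=> s s' t t' _ -> _ ->.
- by move=> s s' _ ->.
- by move=> s t u; rewrite addrA.
- by move=> s t; rewrite addrC.
- by move=> s; rewrite add0r.
- by move=> s; rewrite addNr.
- by move=> x y v; rewrite fDl.
Qed.

Definition tlift (t : tensor) : G := texpr_eval (trepr t).

Lemma tlift_class s : tlift (tclass s) = texpr_eval s.
Proof. exact/texpr_eval_eq/trepr_class. Qed.

Lemma tlift_pure x v : tlift (pure x v) = f x v.
Proof. exact: tlift_class. Qed.

Lemma tliftD : {morph tlift : s t / s + t}.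
Proof.
move=> s t; rewrite -(treprK s) -(treprK t).
by rewrite [_ + _ in LHS]tensor_addE !tlift_class.
Qed.

End Lift.

Lemma tensor_ext (G : zmodType) (f g : tensor -> G) :
  {morph f : s t / s + t} -> {morph g : s t / s + t} ->
  (forall x v, f (pure x v) = g (pure x v)) -> f =1 g.
Proof.
move=> fD gD fg.
have f0 : f 0 = 0 by apply: (addrI (f 0)); rewrite -fD !addr0.
have g0 : g 0 = 0 by apply: (addrI (g 0)); rewrite -gD !addr0.
apply: tensor_elim => [//||s t fgs fgt|s fgs]; first by rewrite f0 g0.
  by rewrite fD gD fgs fgt.
by apply: (addIr (f s)); rewrite -fD fgs -gD !addNr f0 g0.
Qed.

End Tensor.

Section TensorSpace.
Variables (F : comNzRingType) (U W : lmodType F).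

Definition tens : Type :=
  tensor (fun (u : U) (c : F) => c *: u) (fun (c : F) (w : W) => c *: w).
HB.instance Definition _ := GRing.Zmodule.on tens.

Definition tpure (u : U) (w : W) : tens := pure _ _ u w.

Lemma tpureDl w : {morph tpure^~ w : u v / u + v}.
Proof. exact: pureDl. Qed.
Lemma tpureDr u : {morph tpure u : v w / v + w}.
Proof. exact: pureDr. Qed.
Lemma tpure_bal (c : F) u w : tpure (c *: u) w = tpure u (c *: w).
Proof. exact: (pure_bal _ _ u c w). Qed.

Definition tmap (f : {linear U -> U}) (g : {linear W -> W}) (t : tens) : tens :=
  tlift (fun u w => tpure (f u) (g w)) t.

Fact tmap_balanced (f : {linear U -> U}) (g : {linear W -> W}) :
  balanced (fun (u : U) (c : F) => c *: u) (fun (c : F) (w : W) => c *: w)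
    (fun u w => tpure (f u) (g w)).
Proof.
split=> [w u v|u v w|u c w] /=.
- by rewrite raddfD tpureDl.
- by rewrite raddfD tpureDr.
- by rewrite !linearZ /= tpure_bal.
Qed.

Lemma tmap_pure f g u w : tmap f g (tpure u w) = tpure (f u) (g w).
Proof. exact: tlift_pure (tmap_balanced f g) u w. Qed.
Lemma tmapD f g : {morph tmap f g : s t / s + t}.
Proof. exact: tliftD (tmap_balanced f g). Qed.

Lemma tens_ext (G : zmodType) (f g : tens -> G) :
  {morph f : s t / s + t} -> {morph g : s t / s + t} ->
  (forall u w, f (tpure u w) = g (tpure u w)) -> f =1 g.
Proof. exact: tensor_ext. Qed.

Definition tens_scale (c : F) : tens -> tens := tmap ( *:%R c) idfun.

Fact tens_scaleA c d t : tens_scale c (tens_scale d t) = tens_scale (c * d) t.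
Proof.
move: t; apply: tens_ext => [s t|s t|u w]; rewrite /tens_scale ?tmapD //.
by rewrite !tmap_pure /= scalerA.
Qed.
Fact tens_scale1 : left_id 1 tens_scale.
Proof.
apply: tens_ext => [s t|s t //|u w]; rewrite /tens_scale ?tmapD //.
by rewrite !tmap_pure /= scale1r.
Qed.
Fact tens_scaleDr : right_distributive tens_scale +%R.
Proof. by move=> c; apply: tmapD. Qed.
Fact tens_scaleDl t : {morph tens_scale^~ t : c d / c + d}.
Proof.
move=> c d; move: t; apply: tens_ext => [s t|s t|u w];
  rewrite /tens_scale ?tmapD 1?addrACA //.
by rewrite !tmap_pure /= scalerDl tpureDl.
Qed.
HB.instance Definition _ := GRing.Zmodule_isLmodule.Build F tens
  tens_scaleA tens_scale1 tens_scaleDr tens_scaleDl.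

Lemma tens_scale_pure (c : F) u w : c *: tpure u w = tpure (c *: u) w.
Proof. exact: tmap_pure. Qed.

Fact tmap_is_linear f g : linear (tmap f g).
Proof.
move=> c s t; rewrite tmapD; congr (_ + _); move: s.
apply: tens_ext => [s s'|s s'|u w].
- by rewrite scalerDr tmapD.
- by rewrite tmapD scalerDr.
by rewrite tens_scale_pure !tmap_pure tens_scale_pure linearZ.
Qed.
HB.instance Definition _ f g :=
  GRing.isLinear.Build F tens tens _ (tmap f g) (tmap_is_linear f g).

End TensorSpace.

(* Induction: A (x)_B V, where B acts on the right of A through iota. *)
Section Induction.
Variables (B A : pzRingType) (iota : {rmorphism B -> A}) (V : lmodType B).

Definition induced : Type :=
  tensor (fun (a : A) (b : B) => a * iota b) (fun (b : B) (v : V) => b *: v).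
HB.instance Definition _ := GRing.Zmodule.on induced.

Definition ipure (a : A) (v : V) : induced := pure _ _ a v.

Definition induced_scale (c : A) (t : induced) : induced :=
  tlift (fun a v => ipure (c * a) v) t.

Fact induced_scale_balanced c :
  balanced (fun (a : A) (b : B) => a * iota b) (fun (b : B) (v : V) => b *: v)
    (fun a v => ipure (c * a) v).
Proof.
split=> [v a b|a v w|a b v] /=.
- by rewrite mulrDr; apply: pureDl.
- exact: pureDr.
- by rewrite mulrA; apply: (pure_bal _ _ (c * a) b v).
Qed.

Lemma induced_scale_pure c a v :
  induced_scale c (ipure a v) = ipure (c * a) v.
Proof. exact: tlift_pure (induced_scale_balanced c) a v. Qed.

Fact induced_scaleDr : right_distributive induced_scale +%R.
Proof. by move=> c; apply: tliftD (induced_scale_balanced c). Qed.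
Fact induced_scaleA c d t :
  induced_scale c (induced_scale d t) = induced_scale (c * d) t.
Proof.
move: t; apply: tensor_ext => [s t|s t|a v]; rewrite ?induced_scaleDr //.
by rewrite !induced_scale_pure mulrA.
Qed.
Fact induced_scale1 : left_id 1 induced_scale.
Proof.
apply: tensor_ext => [s t|s t //|a v]; rewrite ?induced_scaleDr //.
by rewrite induced_scale_pure mul1r.
Qed.
Fact induced_scaleDl t : {morph induced_scale^~ t : c d / c + d}.
Proof.
move=> c d; move: t; apply: tensor_ext => [s t|s t|a v];
  rewrite ?induced_scaleDr 1?addrACA //.
by rewrite !induced_scale_pure mulrDl; apply: pureDl.
Qed.
HB.instance Definition _ := GRing.Zmodule_isLmodule.Build A induced
  induced_scaleA induced_scale1 induced_scaleDr induced_scaleDl.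

End Induction.

(* The ring of endomorphisms of a space V, and V as a module over it. *)
Record endo (F : comNzRingType) (V : lmodType F) : Type := Endo {
  endo_fun :> V -> V;
  endoP : linear endo_fun }.

Definition endospace (F : comNzRingType) (V : lmodType F) : Type := V.

Section Endomorphisms.
Variables (F : comNzRingType) (V : lmodType F).
Local Notation endo := (endo V).

HB.instance Definition _ := gen_eqMixin endo.
HB.instance Definition _ := gen_choiceMixin endo.

Lemma endo_ext (f g : endo) : f =1 g -> f = g.
Proof.
case: f g => [f lf] [g lg] /= /funext fg.
by case: _ / fg lg => lg; congr Endo; apply: Prop_irrelevance.
Qed.

HB.instance Definition _ (f : endo) :=
  GRing.isLinear.Build F V V _ (endo_fun f) (endoP f).

Definition endo_of (f : {linear V -> V}) : endo := Endo (fun c => linearP f c).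

Definition endo_zero : endo := endo_of \0.
Definition endo_opp (f : endo) : endo := endo_of (\- f).
Definition endo_add (f g : endo) : endo := endo_of (f \+ g).
Definition endo_one : endo := endo_of idfun.
Definition endo_mul (f g : endo) : endo := endo_of (f \o g).

Fact endo_addA : associative endo_add.
Proof. by move=> f g h; apply: endo_ext => v /=; rewrite addrA. Qed.
Fact endo_addC : commutative endo_add.
Proof. by move=> f g; apply: endo_ext => v /=; rewrite addrC. Qed.
Fact endo_add0 : left_id endo_zero endo_add.
Proof. by move=> f; apply: endo_ext => v /=; rewrite add0r. Qed.
Fact endo_addN : left_inverse endo_zero endo_opp endo_add.
Proof. by move=> f; apply: endo_ext => v /=; rewrite addNr. Qed.
HB.instance Definition _ :=
  GRing.isZmodule.Build endo endo_addA endo_addC endo_add0 endo_addN.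

Fact endo_mulA : associative endo_mul.
Proof. by move=> f g h; apply: endo_ext. Qed.
Fact endo_mul1 : left_id endo_one endo_mul.
Proof. by move=> f; apply: endo_ext. Qed.
Fact endo_mulr1 : right_id endo_one endo_mul.
Proof. by move=> f; apply: endo_ext. Qed.
Fact endo_mulDl : left_distributive endo_mul +%R.
Proof. by move=> f g h; apply: endo_ext. Qed.
Fact endo_mulDr : right_distributive endo_mul +%R.
Proof. by move=> f g h; apply: endo_ext => v /=; rewrite linearD. Qed.
HB.instance Definition _ := GRing.Zmodule_isPzRing.Build endo
  endo_mulA endo_mul1 endo_mulr1 endo_mulDl endo_mulDr.

Definition endo_scalar (c : F) : endo := endo_of (c \*: idfun).
Fact endo_scalar_is_zmod_morphism : zmod_morphism endo_scalar.
Proof. by move=> c d; apply: endo_ext => v; rewrite /= scalerBl. Qed.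
Fact endo_scalar_is_monoid_morphism : monoid_morphism endo_scalar.
Proof.
by split=> [|c d]; apply: endo_ext => v; rewrite /= ?scale1r ?scalerA.
Qed.
HB.instance Definition _ := GRing.isZmodMorphism.Build F endo endo_scalar
  endo_scalar_is_zmod_morphism.
HB.instance Definition _ := GRing.isMonoidMorphism.Build F endo endo_scalar
  endo_scalar_is_monoid_morphism.
Lemma endo_scalarC c f : endo_scalar c * f = f * endo_scalar c.
Proof. by apply: endo_ext => v; rewrite /= linearZ. Qed.

HB.instance Definition _ := GRing.Zmodule.on (endospace V).
Definition endo_act (f : endo) (v : endospace V) : endospace V := f v.
Fact endo_actA f g v : endo_act f (endo_act g v) = endo_act (f * g) v.
Proof. by []. Qed.
Fact endo_act1 : left_id 1 endo_act.
Proof. by []. Qed.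
Fact endo_actDr : right_distributive endo_act +%R.
Proof. by move=> f u v; apply: (linearD f). Qed.
Fact endo_actDl v : {morph endo_act^~ v : f g / f + g}.
Proof. by []. Qed.
HB.instance Definition _ := GRing.Zmodule_isLmodule.Build endo (endospace V)
  endo_actA endo_act1 endo_actDr endo_actDl.

End Endomorphisms.

(******************************************************************************)
(* The 0-Hecke algebra: formal expressions in the generators, modulo the      *)
(* least congruence imposing the axioms of unital F-algebras and the defining *)
(* relations.                                                                 *)
(******************************************************************************)

Definition hecke_rel (k : nat) (A : pzRingType) (e : 'I_k.-1 -> A) : Prop :=
  [/\ forall i, e i * e i = e i,
      forall i j : 'I_k.-1, j = i.+1 :> nat -> e i * e j * e i = e j * e i * e j
    & forall i j : 'I_k.-1, (i.+1 < j)%N -> e i * e j = e j * e i].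

Section Hecke.
Variables (F : comNzRingType) (k : nat).

Inductive hexpr : Type :=
  HGen of 'I_k.-1 | HZero | HOne | HAdd of hexpr & hexpr | HOpp of hexpr
| HMul of hexpr & hexpr | HScale of F & hexpr.

Inductive heq : hexpr -> hexpr -> Prop :=
| heq_refl x : heq x x
| heq_sym x y : heq x y -> heq y x
| heq_trans y x z : heq x y -> heq y z -> heq x z
| heq_add x x' y y' : heq x x' -> heq y y' -> heq (HAdd x y) (HAdd x' y')
| heq_opp x x' : heq x x' -> heq (HOpp x) (HOpp x')
| heq_mul x x' y y' : heq x x' -> heq y y' -> heq (HMul x y) (HMul x' y')
| heq_scale c x x' : heq x x' -> heq (HScale c x) (HScale c x')
| heq_addA x y z : heq (HAdd x (HAdd y z)) (HAdd (HAdd x y) z)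
| heq_addC x y : heq (HAdd x y) (HAdd y x)
| heq_add0 x : heq (HAdd HZero x) x
| heq_addN x : heq (HAdd (HOpp x) x) HZero
| heq_mulA x y z : heq (HMul x (HMul y z)) (HMul (HMul x y) z)
| heq_mul1l x : heq (HMul HOne x) x
| heq_mul1r x : heq (HMul x HOne) x
| heq_mulDl x y z : heq (HMul (HAdd x y) z) (HAdd (HMul x z) (HMul y z))
| heq_mulDr x y z : heq (HMul x (HAdd y z)) (HAdd (HMul x y) (HMul x z))
| heq_scaleA c d x : heq (HScale c (HScale d x)) (HScale (c * d) x)
| heq_scale1 x : heq (HScale 1 x) x
| heq_scaleDr c x y : heq (HScale c (HAdd x y)) (HAdd (HScale c x) (HScale c y))
| heq_scaleDl c d x : heq (HScale (c + d) x) (HAdd (HScale c x) (HScale d x))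
| heq_scaleAl c x y : heq (HScale c (HMul x y)) (HMul (HScale c x) y)
| heq_scaleAr c x y : heq (HScale c (HMul x y)) (HMul x (HScale c y))
| heq_idem i : heq (HMul (HGen i) (HGen i)) (HGen i)
| heq_braid (i j : 'I_k.-1) : j = i.+1 :> nat ->
    heq (HMul (HMul (HGen i) (HGen j)) (HGen i))
        (HMul (HMul (HGen j) (HGen i)) (HGen j))
| heq_comm (i j : 'I_k.-1) : (i.+1 < j)%N ->
    heq (HMul (HGen i) (HGen j)) (HMul (HGen j) (HGen i)).

Definition heqb (x y : {classic hexpr}) : bool := `[< heq x y >].
Fact heqb_equiv : equiv_class_of heqb.
Proof.
split=> [x|x y|y x z]; first exact/asboolP/heq_refl.
  by apply/asboolP/asboolP; apply: heq_sym.
by move=> /asboolP xy /asboolP yz; apply/asboolP; apply: heq_trans yz.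
Qed.
Canonical heqb_equivrel := EquivRelPack heqb_equiv.

Definition hecke : Type := {eq_quot heqb}.
HB.instance Definition _ := Choice.on hecke.

Definition hclass (x : hexpr) : hecke :=
  \pi_({eq_quot heqb}) (x : {classic hexpr}).
Definition hrepr (x : hecke) : hexpr :=
  generic_quotient.repr (x : {eq_quot heqb}).

Lemma hclassP x y : hclass x = hclass y <-> heq x y.
Proof. by split=> [/eqmodP/asboolP//|xy]; apply/eqmodP/asboolP. Qed.

Lemma hreprK : cancel hrepr hclass.
Proof. exact: reprK. Qed.

Lemma hrepr_class x : heq (hrepr (hclass x)) x.
Proof. by apply/hclassP; rewrite hreprK. Qed.

Definition hecke_zero := hclass HZero.
Definition hecke_one := hclass HOne.
Definition hecke_add x y := hclass (HAdd (hrepr x) (hrepr y)).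
Definition hecke_opp x := hclass (HOpp (hrepr x)).
Definition hecke_mul x y := hclass (HMul (hrepr x) (hrepr y)).
Definition hecke_scale c x := hclass (HScale c (hrepr x)).

Lemma hecke_addE x y : hecke_add (hclass x) (hclass y) = hclass (HAdd x y).
Proof. by apply/hclassP; apply: heq_add; apply: hrepr_class. Qed.
Lemma hecke_oppE x : hecke_opp (hclass x) = hclass (HOpp x).
Proof. by apply/hclassP; apply: heq_opp; apply: hrepr_class. Qed.
Lemma hecke_mulE x y : hecke_mul (hclass x) (hclass y) = hclass (HMul x y).
Proof. by apply/hclassP; apply: heq_mul; apply: hrepr_class. Qed.
Lemma hecke_scaleE c x : hecke_scale c (hclass x) = hclass (HScale c x).
Proof. by apply/hclassP; apply: heq_scale; apply: hrepr_class. Qed.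

Let heckeE := (hecke_addE, hecke_oppE, hecke_mulE, hecke_scaleE).

Lemma hecke_ind (P : hecke -> Prop) : (forall x, P (hclass x)) -> forall x, P x.
Proof. by move=> Px x; rewrite -(hreprK x). Qed.

Fact hecke_addA : associative hecke_add.
Proof.
elim/hecke_ind=> x; elim/hecke_ind=> y; elim/hecke_ind=> z; rewrite !heckeE.
exact/hclassP/heq_addA.
Qed.
Fact hecke_addC : commutative hecke_add.
Proof. by move=> x y; apply/hclassP/heq_addC. Qed.
Fact hecke_add0 : left_id hecke_zero hecke_add.
Proof. elim/hecke_ind=> x; rewrite !heckeE; exact/hclassP/heq_add0. Qed.
Fact hecke_addN : left_inverse hecke_zero hecke_opp hecke_add.
Proof. elim/hecke_ind=> x; rewrite !heckeE; exact/hclassP/heq_addN. Qed.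
HB.instance Definition _ := GRing.isZmodule.Build hecke
  hecke_addA hecke_addC hecke_add0 hecke_addN.

Fact hecke_mulA : associative hecke_mul.
Proof.
elim/hecke_ind=> x; elim/hecke_ind=> y; elim/hecke_ind=> z; rewrite !heckeE.
exact/hclassP/heq_mulA.
Qed.
Fact hecke_mul1 : left_id hecke_one hecke_mul.
Proof. elim/hecke_ind=> x; rewrite !heckeE; exact/hclassP/heq_mul1l. Qed.
Fact hecke_mulr1 : right_id hecke_one hecke_mul.
Proof. elim/hecke_ind=> x; rewrite !heckeE; exact/hclassP/heq_mul1r. Qed.
Fact hecke_mulDl : left_distributive hecke_mul hecke_add.
Proof.
elim/hecke_ind=> x; elim/hecke_ind=> y; elim/hecke_ind=> z; rewrite !heckeE.
exact/hclassP/heq_mulDl.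
Qed.
Fact hecke_mulDr : right_distributive hecke_mul hecke_add.
Proof.
elim/hecke_ind=> x; elim/hecke_ind=> y; elim/hecke_ind=> z; rewrite !heckeE.
exact/hclassP/heq_mulDr.
Qed.
HB.instance Definition _ := GRing.Zmodule_isPzRing.Build hecke
  hecke_mulA hecke_mul1 hecke_mulr1 hecke_mulDl hecke_mulDr.

Fact hecke_scaleA c d x :
  hecke_scale c (hecke_scale d x) = hecke_scale (c * d) x.
Proof. elim/hecke_ind: x => x; rewrite !heckeE; exact/hclassP/heq_scaleA. Qed.
Fact hecke_scale1 : left_id 1 hecke_scale.
Proof. elim/hecke_ind=> x; rewrite !heckeE; exact/hclassP/heq_scale1. Qed.
Fact hecke_scaleDr : right_distributive hecke_scale hecke_add.
Proof.
move=> c; elim/hecke_ind=> x; elim/hecke_ind=> y; rewrite !heckeE.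
exact/hclassP/heq_scaleDr.
Qed.
Fact hecke_scaleDl x c d :
  hecke_scale (c + d) x = hecke_add (hecke_scale c x) (hecke_scale d x).
Proof. elim/hecke_ind: x => x; rewrite !heckeE; exact/hclassP/heq_scaleDl. Qed.
HB.instance Definition _ := GRing.Zmodule_isLmodule.Build F hecke
  hecke_scaleA hecke_scale1 hecke_scaleDr hecke_scaleDl.

Definition hpi (i : 'I_k.-1) : hecke := hclass (HGen i).

Lemma hpi_rel : hecke_rel hpi.
Proof.
split=> [i|i j ij|i j ij]; rewrite /hpi.
- rewrite [LHS]hecke_mulE; exact/hclassP/heq_idem.
- rewrite [LHS](congr1 (hecke_mul^~ _) (hecke_mulE _ _)).
  rewrite [RHS](congr1 (hecke_mul^~ _) (hecke_mulE _ _)) !hecke_mulE.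
  exact/hclassP/heq_braid.
- rewrite [LHS]hecke_mulE [RHS]hecke_mulE; exact/hclassP/heq_comm.
Qed.

(* The universal property, for a ring A with a central ring morphism F -> A. *)
Section Lift.
Variables (A : pzRingType) (j : {rmorphism F -> A}) (e : 'I_k.-1 -> A).

Fixpoint hexpr_eval (x : hexpr) : A :=
  match x with
  | HGen i => e i
  | HZero => 0
  | HOne => 1
  | HAdd x y => hexpr_eval x + hexpr_eval y
  | HOpp x => - hexpr_eval x
  | HMul x y => hexpr_eval x * hexpr_eval y
  | HScale c x => j c * hexpr_eval x
  end.

Definition hlift (jC : forall c x, j c * x = x * j c) (eP : hecke_rel e)
  (x : hecke) : A := hexpr_eval (hrepr x).

Hypotheses (jC : forall c x, j c * x = x * j c) (eP : hecke_rel e).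

Lemma hexpr_eval_eq x y : heq x y -> hexpr_eval x = hexpr_eval y.
Proof.
have [e_idem e_braid e_comm] := eP.
elim=> {x y} //=.
- by move=> y x z _ -> _ ->.
- by move=> x x' y y' _ -> _ ->.
- by move=> x x' _ ->.
- by move=> x x' y y' _ -> _ ->.
- by move=> c x x' _ ->.
- by move=> x y z; rewrite addrA.
- by move=> x y; rewrite addrC.
- by move=> x; rewrite add0r.
- by move=> x; rewrite addNr.
- by move=> x y z; rewrite mulrA.
- by move=> x; rewrite mul1r.
- by move=> x; rewrite mulr1.
- by move=> x y z; rewrite mulrDl.
- by move=> x y z; rewrite mulrDr.
- by move=> c d x; rewrite rmorphM mulrA.
- by move=> x; rewrite rmorph1 mul1r.
- by move=> c x y; rewrite mulrDr.
- by move=> c d x; rewrite rmorphD mulrDl.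
- by move=> c x y; rewrite mulrA.
- by move=> c x y; rewrite mulrA jC mulrA.
Qed.

Lemma hlift_class x : hlift jC eP (hclass x) = hexpr_eval x.
Proof. exact/hexpr_eval_eq/hrepr_class. Qed.

Lemma hlift_hpi i : hlift jC eP (hpi i) = e i.
Proof. exact: hlift_class. Qed.

Lemma hlift_scale c x : hlift jC eP (c *: x) = j c * hlift jC eP x.
Proof.
elim/hecke_ind: x => x.
by rewrite [c *: _ in LHS]hecke_scaleE !hlift_class.
Qed.

Fact hlift_is_zmod_morphism : zmod_morphism (hlift jC eP).
Proof.
elim/hecke_ind=> x; elim/hecke_ind=> y.
by rewrite [- _ in LHS]hecke_oppE [_ + _ in LHS]hecke_addE !hlift_class.
Qed.
HB.instance Definition _ :=
  GRing.isZmodMorphism.Build hecke A (hlift jC eP) hlift_is_zmod_morphism.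

Fact hlift_is_monoid_morphism : monoid_morphism (hlift jC eP).
Proof.
split; first exact: hlift_class.
elim/hecke_ind=> x; elim/hecke_ind=> y.
by rewrite [_ * _ in LHS]hecke_mulE !hlift_class.
Qed.
HB.instance Definition _ :=
  GRing.isMonoidMorphism.Build hecke A (hlift jC eP) hlift_is_monoid_morphism.

End Lift.

Fact hecke_one_neq0 : (1 : hecke) != 0.
Proof.
have jC (c x : F) : idfun c * x = x * idfun c by rewrite mulrC.
have eP : hecke_rel (fun _ : 'I_k.-1 => 1 : F) by split=> *; rewrite !mulr1.
apply/eqP => /(congr1 (hlift jC eP)) /eqP.
by rewrite rmorph1 rmorph0 oner_eq0.
Qed.
HB.instance Definition _ := GRing.PzSemiRing_isNonZero.Build hecke hecke_one_neq0.

Fact hecke_scaleAl (c : F) (x y : hecke) :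
  hecke_scale c (hecke_mul x y) = hecke_mul (hecke_scale c x) y.
Proof.
elim/hecke_ind: x => x; elim/hecke_ind: y => y; rewrite !heckeE.
exact/hclassP/heq_scaleAl.
Qed.
HB.instance Definition _ :=
  GRing.Lmodule_isLalgebra.Build F hecke hecke_scaleAl.
Fact hecke_scaleAr (c : F) (x y : hecke) :
  hecke_scale c (hecke_mul x y) = hecke_mul x (hecke_scale c y).
Proof.
elim/hecke_ind: x => x; elim/hecke_ind: y => y; rewrite !heckeE.
exact/hclassP/heq_scaleAr.
Qed.
HB.instance Definition _ := GRing.Lalgebra_isAlgebra.Build F hecke hecke_scaleAr.

Section AlgLift.
Variables (A : algType F) (e : 'I_k.-1 -> A).

Fact in_algC (c : F) (x : A) : in_alg A c * x = x * in_alg A c.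
Proof. by rewrite /= mulr_algl mulr_algr. Qed.

Definition halift (eP : hecke_rel e) : hecke -> A := hlift in_algC eP.
Variable eP : hecke_rel e.
HB.instance Definition _ := GRing.RMorphism.on (halift eP).

Fact halift_is_scalable : scalable (halift eP).
Proof. by move=> c x; rewrite /halift hlift_scale /= mulr_algl. Qed.
HB.instance Definition _ :=
  GRing.isScalable.Build F hecke A _ (halift eP) halift_is_scalable.

Lemma halift_hpi i : halift eP (hpi i) = e i.
Proof. exact: hlift_hpi. Qed.

End AlgLift.

Lemma hecke_lrmorphism_ext (A : algType F) (f g : {lrmorphism hecke -> A}) :
  (forall i, f (hpi i) = g (hpi i)) -> f =1 g.
Proof.
move=> fg; elim/hecke_ind; elim=> [i|||x Hx y Hy|x Hx|x Hx y Hy|c x Hx].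
- exact: fg.
- exact: etrans (rmorph0 f) (esym (rmorph0 g)).
- exact: etrans (rmorph1 f) (esym (rmorph1 g)).
- by rewrite -hecke_addE -[hecke_add _ _]/(hclass x + hclass y) !rmorphD /= Hx Hy.
- by rewrite -hecke_oppE -[hecke_opp _]/(- hclass x) !rmorphN /= Hx.
- by rewrite -hecke_mulE -[hecke_mul _ _]/(hclass x * hclass y) !rmorphM /= Hx Hy.
- by rewrite -hecke_scaleE -[hecke_scale _ _]/(c *: hclass x) !linearZ /= Hx.
Qed.

(* The element written as pi with an overline. *)
Definition hpibar (i : 'I_k.-1) : hecke := hpi i - 1.

Fact hphi_rel : hecke_rel (fun i => hpi (rev_ord i)).
Proof.
have [pi_idem pi_braid pi_comm] := hpi_rel.
split=> [i|i j ij|i j ij]; first exact: pi_idem.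
  by apply/esym/pi_braid => /=; have := ltn_ord j; lia.
by apply/esym/pi_comm => /=; have := ltn_ord j; lia.
Qed.

Fact htheta_rel : hecke_rel (fun i => - hpibar i).
Proof.
have [pi_idem pi_braid pi_comm] := hpi_rel.
have E i : - hpibar i = 1 - hpi i by rewrite /hpibar opprB.
split=> [i|i j ij|i j ij]; rewrite !E.
- by rewrite mulrBl mul1r mulrBr mulr1 pi_idem subrr subr0.
- have E3 i' j' : (1 - hpi i') * (1 - hpi j') * (1 - hpi i')
      = 1 - (hpi i' + hpi j') + (hpi i' * hpi j' + hpi j' * hpi i')
        - hpi i' * hpi j' * hpi i'.
    rewrite [X in X * _]mulrBr mulr1 mulrBl.
    have -> : (1 - hpi i') * (1 - hpi i') = 1 - hpi i'.
      by rewrite mulrBl mul1r mulrBr mulr1 pi_idem subrr subr0.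
    rewrite mulrBl mul1r mulrBr mulr1 mulrBl !opprB !opprD !addrA.
    by rewrite [LHS](ACl (1*2*6*5*3*4))%AC.
  by rewrite !E3 pi_braid // [hpi i + _]addrC [hpi i * _ + _]addrC.
- rewrite !(mulrBl, mulrBr, mul1r, mulr1) pi_comm // !opprB !addrA.
  by rewrite [LHS](ACl (1*4*3*2))%AC.
Qed.

Fact hchi_rel : hecke_rel (hpi : 'I_k.-1 -> hecke^c).
Proof.
have [pi_idem pi_braid pi_comm] := hpi_rel.
split=> [i|i j ij|i j ij]; first exact: pi_idem.
  by rewrite [LHS](mulrA (hpi i : hecke)) [RHS](mulrA (hpi j : hecke)) pi_braid.
exact/esym/pi_comm.
Qed.

End Hecke.

Section Involutions.
Variables (F : comNzRingType) (k : nat).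
Local Notation H := (hecke F k).

(* In terms of the shifted indices, k - (i + 1) = rev_ord i + 1. *)
Definition hphi : {lrmorphism H -> H} := halift (@hphi_rel F k).
Definition htheta : {lrmorphism H -> H} := halift (@htheta_rel F k).
Definition hchi : {lrmorphism H -> H^c} := halift (@hchi_rel F k).

Lemma hphi_hpi i : hphi (hpi F i) = hpi F (rev_ord i).
Proof. exact: halift_hpi. Qed.
Lemma htheta_hpi i : htheta (hpi F i) = - hpibar F i.
Proof. exact: halift_hpi. Qed.
Lemma hchi_hpi i : hchi (hpi F i) = hpi F i.
Proof. exact: halift_hpi. Qed.

End Involutions.

Section GeneratedSubalgebra.
Variables (F : comNzRingType) (A : algType F) (G : A -> Prop).

Definition gensub : {pred A} :=
  fun x => `[< forall S : {pred A}, subalg_closed S ->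
                 (forall g, G g -> g \in S) -> x \in S >].

Fact gensub_closed : subalg_closed gensub.
Proof.
split=> [|c x y /asboolP Sx /asboolP Sy|x y /asboolP Sx /asboolP Sy];
  apply/asboolP => S SP GS; have [S1 Slin SM] := SP.
- exact: S1.
- by apply: Slin; [apply: Sx | apply: Sy].
- by apply: SM; [apply: Sx | apply: Sy].
Qed.
HB.instance Definition _ := GRing.isSubalgClosed.Build F A gensub
  (GRing.subalg_closed_semi gensub_closed).

Lemma gensub_gen g : G g -> g \in gensub.
Proof. by move=> Gg; apply/asboolP => S _; apply. Qed.

Lemma gensub_min (S : {pred A}) :
  subalg_closed S -> (forall g, G g -> g \in S) -> {subset gensub <= S}.
Proof. by move=> SP GS x /asboolP; apply. Qed.

End GeneratedSubalgebra.

(* parab F k a is the subalgebra of H_k(0) generated by the pi_i with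
   i in [k-1] \ {a}; it is H_a(0) (x) H_b(0) when k = a + b. *)
Section Parabolic.
Variables (F : comNzRingType) (k a : nat).
Local Notation H := (hecke F k).

Definition parab_gen (x : H) : Prop :=
  exists2 i : 'I_k.-1, i.+1 != a & x = hpi F i.

Record parab : Type := Parab {
  parab_val :> H;
  parabP : parab_val \in gensub parab_gen }.

HB.instance Definition _ := [isSub of parab for parab_val].
HB.instance Definition _ := [Choice of parab by <:].
HB.instance Definition _ := [SubChoice_isSubAlgebra of parab by <:].

Fact parab_val_is_linear : linear parab_val.
Proof. by []. Qed.
Fact parab_val_is_monoid_morphism : monoid_morphism parab_val.
Proof. by []. Qed.
HB.instance Definition _ :=
  GRing.isLinear.Build F parab H _ parab_val parab_val_is_linear.
HB.instance Definition _ := GRing.isMonoidMorphism.Build parab H parab_val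
  parab_val_is_monoid_morphism.
Definition parab_incl : {lrmorphism parab -> H} := parab_val.

End Parabolic.

Section Restrictions.
Variable F : comNzRingType.

Fact parab_phi_subproof m n (x : parab F (m + n) m) :
  hphi F (m + n) (parab_val x) \in gensub (@parab_gen F (m + n) n).
Proof.
case: x => x /=; have [S1 Slin SM] := gensub_closed (@parab_gen F (m + n) n).
pose S := [pred y | hphi F (m + n) y \in gensub (@parab_gen F (m + n) n)].
move: x; apply: (@gensub_min _ _ _ S) => [|_ [i im ->]].
  split=> [|c x y|x y]; rewrite !inE ?rmorph1 // => Sx Sy.
    by rewrite linearP; apply: Slin.
  by rewrite rmorphM; apply: SM.
rewrite inE hphi_hpi; apply: gensub_gen; exists (rev_ord i) => //=.
by have := ltn_ord i; lia.
Qed.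
Definition parab_phi_fun m n (x : parab F (m + n) m) : parab F (m + n) n :=
  Parab (parab_phi_subproof x).

Variables (k a : nat).

Fact parab_theta_subproof (x : parab F k a) :
  htheta F k (parab_val x) \in gensub (@parab_gen F k a).
Proof.
case: x => x /=; have [S1 Slin SM] := gensub_closed (@parab_gen F k a).
pose S := [pred y | htheta F k y \in gensub (@parab_gen F k a)].
move: x; apply: (@gensub_min _ _ _ S) => [|_ [i ia ->]].
  split=> [|c x y|x y]; rewrite !inE ?rmorph1 // => Sx Sy.
    by rewrite linearP; apply: Slin.
  by rewrite rmorphM; apply: SM.
rewrite inE htheta_hpi /hpibar opprB addrC -scaleN1r; apply: Slin => //.
by apply: gensub_gen; exists i.
Qed.
Definition parab_theta_fun (x : parab F k a) : parab F k a :=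
  Parab (parab_theta_subproof x).

Fact parab_chi_subproof (x : parab F k a) :
  (hchi F k (parab_val x) : hecke F k) \in gensub (@parab_gen F k a).
Proof.
case: x => x /=; have [S1 Slin SM] := gensub_closed (@parab_gen F k a).
pose S := [pred y | (hchi F k y : hecke F k) \in gensub (@parab_gen F k a)].
move: x; apply: (@gensub_min _ _ _ S) => [|_ [i ia ->]].
  split=> [|c x y|x y]; rewrite !inE ?rmorph1 // => Sx Sy.
    by rewrite linearP; apply: Slin.
  by rewrite rmorphM; apply: SM.
by rewrite inE hchi_hpi; apply: gensub_gen; exists i.
Qed.
Definition parab_chi_fun (x : parab F k a) : (parab F k a)^c :=
  Parab (parab_chi_subproof x).

End Restrictions.

Section RestrictionMorphisms.
Variable F : comNzRingType.

Fact parab_phi_linear m n : linear (@parab_phi_fun F m n).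
Proof. by move=> c x y; apply: val_inj; rewrite /= linearP. Qed.
Fact parab_phi_monoid m n : monoid_morphism (@parab_phi_fun F m n).
Proof.
by split=> [|x y]; apply: val_inj; rewrite /= ?rmorph1 ?rmorphM.
Qed.
HB.instance Definition _ m n := GRing.isLinear.Build F _ _ _
  (@parab_phi_fun F m n) (@parab_phi_linear m n).
HB.instance Definition _ m n := GRing.isMonoidMorphism.Build _ _
  (@parab_phi_fun F m n) (@parab_phi_monoid m n).
Definition parab_phi m n :
  {lrmorphism parab F (m + n) m -> parab F (m + n) n} := @parab_phi_fun F m n.

Variables k a : nat.

Fact parab_theta_linear : linear (@parab_theta_fun F k a).
Proof. by move=> c x y; apply: val_inj; rewrite /= linearP. Qed.
Fact parab_theta_monoid : monoid_morphism (@parab_theta_fun F k a).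
Proof.
by split=> [|x y]; apply: val_inj; rewrite /= ?rmorph1 ?rmorphM.
Qed.
HB.instance Definition _ := GRing.isLinear.Build F _ _ _
  (@parab_theta_fun F k a) parab_theta_linear.
HB.instance Definition _ := GRing.isMonoidMorphism.Build _ _
  (@parab_theta_fun F k a) parab_theta_monoid.
Definition parab_theta : {lrmorphism parab F k a -> parab F k a} :=
  @parab_theta_fun F k a.

Fact parab_chi_linear : linear (@parab_chi_fun F k a).
Proof.
move=> c x y; apply: (@val_inj _ _ (parab F k a)).
by rewrite /= linearP.
Qed.
Fact parab_chi_monoid : monoid_morphism (@parab_chi_fun F k a).
Proof.
by split=> [|x y]; apply: (@val_inj _ _ (parab F k a));
  rewrite /= ?rmorph1 ?rmorphM.
Qed.
HB.instance Definition _ := GRing.isLinear.Build F _ _ _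
  (@parab_chi_fun F k a) parab_chi_linear.
HB.instance Definition _ := GRing.isMonoidMorphism.Build _ _
  (@parab_chi_fun F k a) parab_chi_monoid.
Definition parab_chi : {lrmorphism parab F k a -> (parab F k a)^c} :=
  @parab_chi_fun F k a.

End RestrictionMorphisms.

Section LinearAction.
Variables (F : comNzRingType) (A : algType F) (M : lmodType A).

Definition lact (x : A) (v : vspaceof M) : vspaceof M := x *: (v : M).

Fact lact_is_linear x : linear (lact x).
Proof.
move=> c u v; rewrite /lact -[X in _ *: (X + _)]/(c%:A *: (u : M)) scalerDr.
by congr (_ + _); rewrite -[RHS]/(c%:A *: (x *: (u : M))) !scalerA mulr_algl mulr_algr.
Qed.
HB.instance Definition _ x := GRing.isLinear.Build F _ _ _
  (lact x) (lact_is_linear x).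

Lemma lactM x y v : lact x (lact y v) = lact (x * y) v.
Proof. exact: (@scalerA A M). Qed.

End LinearAction.

(******************************************************************************)
(* M (x) N as a module over H_a(0) (x) H_b(0) = parab F k a, for k = a + b.   *)
(* Setting pi_a = 0 is compatible with the relations of H_k(0), and defines a *)
(* retraction of H_k(0) onto H_a(0) (x) H_b(0); so there is an action of      *)
(* H_k(0) on M (x) N where pi_i acts as pi_i (x) 1 for i < a, as 0 for i = a, *)
(* and as 1 (x) pi_(i-a) for i > a. Its restriction to parab F k a is the     *)
(* intended module: the value chosen for pi_a plays no role there.            *)
(* The argument k, rather than a + b, lets both M (x) N and N (x) M yield     *)
(* modules of the same H_k(0).                                                *)
(******************************************************************************)

Section OuterTensor.
Variables (F : comNzRingType) (k a b : nat).
Variables (M : lmodType (hecke F a)) (N : lmodType (hecke F b)).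

Definition split_idx (i : nat) : option ('I_a.-1 + 'I_b.-1) :=
  if (i.+1 < a)%N then omap inl (insub i)
  else if (i.+1 == a)%N then None else omap inr (insub (i - a)%N).

Variant split_idx_spec (i : nat) : option ('I_a.-1 + 'I_b.-1) -> Prop :=
| SplitLeft (j : 'I_a.-1) of i = j :> nat : split_idx_spec i (Some (inl j))
| SplitRight (j : 'I_b.-1) of i = (a + j)%N : split_idx_spec i (Some (inr j))
| SplitNone : split_idx_spec i None.

Lemma split_idxP i : split_idx_spec i (split_idx i).
Proof.
rewrite /split_idx; case: ltngtP => [lt_ia|lt_ai|_] /=; last exact: SplitNone.
  case: insubP => [j _ Ej|] /=; last by move/negP; lia.
  exact: SplitLeft.
case: insubP => [j _ Ej|_] /=; last exact: SplitNone.
by apply: SplitRight; rewrite Ej; lia.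
Qed.

Local Notation T := (tens (vspaceof M) (vspaceof N)).

Definition mtens_gen (i : 'I_k.-1) : endo T :=
  match split_idx i with
  | Some (inl j) => endo_of (tmap (lact (hpi F j)) idfun)
  | Some (inr j) => endo_of (tmap idfun (lact (hpi F j)))
  | None => 0
  end.

Lemma endo_tens_ext (f g : endo T) :
  (forall u w, f (tpure u w) = g (tpure u w)) -> f = g.
Proof.
by move=> fg; apply/endo_ext/tens_ext => [s t|s t|//]; rewrite linearD.
Qed.

Fact mtens_rel : hecke_rel mtens_gen.
Proof.
have [ai ab ac] := hpi_rel F a; have [bi bb bc] := hpi_rel F b.
split=> [i|i j ij|i j ij]; rewrite /mtens_gen.
- case: split_idxP => [p _|q _|]; last by rewrite mul0r.
    by apply: endo_tens_ext => u w; rewrite /= !tmap_pure /= lactM ai.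
  by apply: endo_tens_ext => u w; rewrite /= !tmap_pure /= lactM bi.
- case: (split_idxP i) => [p ip|p ip|]; last by rewrite !(mul0r, mulr0).
    case: (split_idxP j) => [q jq|q jq|]; last by rewrite !(mul0r, mulr0).
      apply: endo_tens_ext => u w; rewrite /= !tmap_pure /= !lactM ab //.
      by rewrite -jq -ip.
    by have := ltn_ord p; lia.
  case: (split_idxP j) => [q jq|q jq|]; last by rewrite !(mul0r, mulr0).
    by have := ltn_ord q; lia.
  apply: endo_tens_ext => u w; rewrite /= !tmap_pure /= !lactM bb //.
  by lia.
- case: (split_idxP i) => [p ip|p ip|]; last by rewrite mul0r mulr0.
    case: (split_idxP j) => [q jq|q jq|]; last by rewrite mul0r mulr0.
      apply: endo_tens_ext => u w; rewrite /= !tmap_pure /= !lactM ac //.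
      by rewrite -jq -ip.
    by apply: endo_tens_ext => u w; rewrite /= !tmap_pure.
  case: (split_idxP j) => [q jq|q jq|]; last by rewrite mul0r mulr0.
    by apply: endo_tens_ext => u w; rewrite /= !tmap_pure.
  apply: endo_tens_ext => u w; rewrite /= !tmap_pure /= !lactM bc //.
  by lia.
Qed.

Definition mtens_morphism : {rmorphism hecke F k -> endo T} :=
  hlift (@endo_scalarC F T) mtens_rel.

Definition mtens : Type :=
  pullback (parab_incl F k a) (pullback mtens_morphism (endospace T)).
HB.instance Definition _ := GRing.Lmodule.on mtens.

Definition mpure (u : M) (w : N) : mtens := tpure (u : vspaceof M) (w : vspaceof N).

Lemma split_idx_left (j : 'I_a.-1) : split_idx j = Some (inl j).
Proof.
rewrite /split_idx (_ : (j.+1 < a)%N); last by have := ltn_ord j; lia.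
by rewrite valK.
Qed.
Lemma split_idx_right (j : 'I_b.-1) : split_idx (a + j) = Some (inr j).
Proof.
rewrite /split_idx (_ : ((a + j).+1 < a)%N = false); last by lia.
by rewrite (_ : ((a + j).+1 == a) = false) ?addKn ?valK //; lia.
Qed.

Lemma mtensE (x : parab F k a) (t : mtens) :
  x *: t = mtens_morphism (parab_val x) t.
Proof. by []. Qed.

Lemma mtens_left (x : parab F k a) (i : 'I_k.-1) (j : 'I_a.-1) u w :
  i = j :> nat -> parab_val x = hpi F i ->
  x *: mpure u w = mpure (hpi F j *: u) w.
Proof.
move=> ij xi; rewrite mtensE xi /mtens_morphism /= hlift_hpi /mtens_gen ij.
by rewrite split_idx_left /= tmap_pure.
Qed.
Lemma mtens_right (x : parab F k a) (i : 'I_k.-1) (j : 'I_b.-1) u w :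
  i = (a + j)%N :> nat -> parab_val x = hpi F i ->
  x *: mpure u w = mpure u (hpi F j *: w).
Proof.
move=> ij xi; rewrite mtensE xi /mtens_morphism /= hlift_hpi /mtens_gen ij.
by rewrite split_idx_right /= tmap_pure.
Qed.

End OuterTensor.

Section ModuleOperations.
Variable F : comNzRingType.

Definition boxtimes (k a b : nat) (M : lmodType (hecke F a))
    (N : lmodType (hecke F b)) : lmodType (hecke F k) :=
  induced (parab_incl F k a) (mtens k M N).

Definition restr (k a : nat) (L : lmodType (hecke F k)) :
    lmodType (parab F k a) :=
  pullback (parab_incl F k a) L.

Definition phi_twist (k : nat) (V : lmodType (hecke F k)) :
  lmodType (hecke F k) := pullback (hphi F k) V.
Definition theta_twist (k : nat) (V : lmodType (hecke F k)) :
  lmodType (hecke F k) := pullback (htheta F k) V.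
Definition chi_twist (k : nat) (V : lmodType (hecke F k)) :
  lmodType (hecke F k) := dual (hchi F k) V.

Definition parab_phi_twist (m n : nat) (V : lmodType (parab F (m + n) n)) :
  lmodType (parab F (m + n) m) := pullback (parab_phi F m n) V.
Definition parab_theta_twist (k a : nat) (V : lmodType (parab F k a)) :
  lmodType (parab F k a) := pullback (parab_theta F k a) V.
Definition parab_chi_twist (k a : nat) (V : lmodType (parab F k a)) :
  lmodType (parab F k a) := dual (parab_chi F k a) V.

End ModuleOperations.

(* M is (isomorphic to) B(s, t), through b; it is zero unless leL s t. *)
Definition interval_module (F : comNzRingType) (k : nat) (s t : 'S_k)
    (M : lmodType (hecke F k)) : Prop :=
  exists b : 'S_k -> M,
    (forall v : M, exists! c : {ffun {g : 'S_k | g \in intvL s t} -> F},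
       v = \sum_g ((c g)%:A : hecke F k) *: b (val g))
    /\ (forall (i : 'I_k.-1) (g : 'S_k), g \in intvL s t ->
       hpi F i *: b g =
         if i \in desL g then b g
         else if pcomp (srefl i) g \in intvL s t then b (pcomp (srefl i) g)
         else 0).

Definition weak_bruhat_interval_module (F : comNzRingType) (k : nat)
    (M : lmodType (hecke F k)) : Prop :=
  exists s t : 'S_k, interval_module s t M.

Arguments restr {F k} a L.

(* Main.v *)
From HB Require Import structures.
Require Import Defs.
From mathcomp Require Import all_boot all_fingroup all_algebra.
From mathcomp Require Import zify boolp reals complex.

Set Implicit Arguments.
Unset Strict Implicit.
Unset Printing Implicit Defensive.

Import GRing.Theory.
Local Open Scope ring_scope.

(** The three statements on restrictions hold because both sides are the same
    space with the same action: the twists of the subalgebra are by definition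
    restrictions of the twists of the whole algebra.

    For phi and theta the twist can be pushed through the tensor product: since
    beta = phi or theta is an involution of H_(m+n)(0) carrying the subalgebra
    H_m(0) (x) H_n(0) onto H_n(0) (x) H_m(0), respectively onto itself,
    a (x) t |-> beta(a) (x) s(t) is an isomorphism, where s is u (x) w |->
    w (x) u for phi and the identity for theta.  Balancedness has to be tested
    on the generators only ([bbalanced], [boxtimes_twist_iso]).

    The twist by chi turns induction into coinduction: for T = M (x) N and
    B = H_m(0) (x) H_n(0), it is the dual of H (x)_B T.  Now H = H_(m+n)(0)
    is a Frobenius extension of B, twisted by the isomorphism from
    H_n(0) (x) H_m(0) to B that exchanges the two factors, and this is the
    reason why coinduction becomes induction with the factors in the reverse
    order.  Explicitly, minimal length coset representatives of
    S_m x S_n in S_(m+n) are the m-subsets A of {0, ..., m+n-1}; a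
    descent of A is an i with i not in A and i+1 in A.  Following any chain of
    descents from A to the lowest subset {0, ..., m-1} defines p_A in H as a
    product of generators pi_i ([coset_elt]), and following ascents from A to
    the highest subset {n, ..., m+n-1} defines q_A as a product of factors
    pi_i - 1.  The elements p_A (x) t span H (x)_B T ([boxtimes_coset_ext]).  The
    coefficient of t at the highest subset is a map E : H (x)_B T -> T
    ([top_coef]) that takes pi_i, for i+1 <> n, to the generator pi_i of the
    factor N if i < n, and pi_(i-n) of the factor M otherwise
    ([top_coef_gen]); and p and q are dual families:
    E (chi(q_A) p_D (x) t) is t if A = D, and 0 otherwise ([top_coef_dual]).

    The map E exists because H acts on the functions from subsets to T
    ([coind_rel]); it reads off one value of such a function.  The isomorphism
    sends a (x) s to a . (s o E), and its inverse sends a functional f to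
    the sum of the q_A (x) f(p_A (x) -).  In both, the dual of T has to
    be identified with N^* (x) M^*.  This is where M and N have to be finitely
    generated free over the scalars, with the interval as a basis. *)

(** * Subsets under transpositions of adjacent letters *)

Section Subsets.
Variable k : nat.
Implicit Types (i j : 'I_k.-1) (x y : 'I_k) (A C D : {set 'I_k}) (b : bool).

Definition lo i : 'I_k := Ordinal (ord_lo_subproof i).
Definition hi i : 'I_k := Ordinal (ord_hi_subproof i).

(** Left multiplication by s_i on cosets of a Young subgroup, when A is the set
    of letters that a permutation assigns to the first block. *)
Definition sw i A : {set 'I_k} := srefl i @^-1: A.
(** For letters in A (b true) or outside A (b false), the rank of the letter p
    within its own class: the index of the generator of the smaller algebra
    into which pi_p turns when p and p.+1 lie in the same class. *)
Definition nbelow b A (p : nat) : nat :=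
  #|[set x : 'I_k | ((x \in A) == b) && (x < p)%N]|.
(** Up to a constant, the length of the minimal coset representative. *)
Definition weight A : nat := \sum_(x in A) x.
Definition seg (m : nat) : {set 'I_k} := [set x : 'I_k | (x < m)%N].

Lemma srefl_lo i : srefl i (lo i) = hi i. Proof. exact: tpermL. Qed.
Lemma srefl_hi i : srefl i (hi i) = lo i. Proof. exact: tpermR. Qed.
Lemma srefl_id i x : x != i :> nat -> x != i.+1 :> nat -> srefl i x = x.
Proof. by move=> xi xi1; rewrite tpermD // eq_sym -val_eqE. Qed.
Lemma lo_next i j : j = i.+1 :> nat -> lo j = hi i.
Proof. by move=> ij; apply: val_inj. Qed.

Lemma srefl_far i j x : (i.+1 < j)%N ->
  srefl i (srefl j x) = srefl j (srefl i x).
Proof.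
move=> ij; rewrite -!permM; congr (fun_of_perm _ x).
rewrite [RHS]conjgC; congr (_ * _)%g; rewrite {2}/srefl tpermJ.
by rewrite !srefl_id //=; lia.
Qed.

Lemma mem_sw_lo i A : (lo i \in sw i A) = (hi i \in A).
Proof. by rewrite inE srefl_lo. Qed.
Lemma mem_sw_hi i A : (hi i \in sw i A) = (lo i \in A).
Proof. by rewrite inE srefl_hi. Qed.
Lemma mem_sw_id i A x : x != i :> nat -> x != i.+1 :> nat ->
  (x \in sw i A) = (x \in A).
Proof. by move=> xi xi1; rewrite inE srefl_id. Qed.

Lemma swK i : involutive (sw i).
Proof. by move=> A; apply/setP => x; rewrite !inE tpermK. Qed.
Lemma sw_inj i : injective (sw i).
Proof. exact: can_inj (@swK i). Qed.

Lemma sw_id i A : (lo i \in A) = (hi i \in A) -> sw i A = A.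
Proof.
move=> lh; apply/setP => x; rewrite inE /srefl -/(lo i) -/(hi i).
by case: tpermP => [->|->|//]; rewrite lh.
Qed.

Lemma sw_far i j A : (i.+1 < j)%N -> sw i (sw j A) = sw j (sw i A).
Proof. by move=> ij; apply/setP => x; rewrite !inE (srefl_far x ij). Qed.

Lemma sw_setC i A : sw i (~: A) = ~: sw i A.
Proof. exact: preimsetC. Qed.

Lemma card_sw i A : #|sw i A| = #|A|.
Proof. exact: card_preimset (@perm_inj _ _). Qed.

Lemma srefl_lt j x p : j.+1 != p -> (srefl j x < p)%N = (x < p)%N.
Proof.
move=> jp; rewrite /srefl; case: tpermP => [->|->|//] /=; lia.
Qed.

Lemma nbelow_sw b j A p : j.+1 != p -> nbelow b (sw j A) p = nbelow b A p.
Proof.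
move=> jp; rewrite /nbelow -[RHS](card_preimset _ (@perm_inj _ (srefl j))).
by apply: eq_card => x; rewrite !inE srefl_lt.
Qed.

Lemma nbelowS b A x : nbelow b A x.+1 = (nbelow b A x + ((x \in A) == b))%N.
Proof.
rewrite /nbelow -!sum1_card (bigID (pred1 x)) /= addnC; congr addn.
  apply: eq_bigl => y; rewrite !inE ltnS -val_eqE /=.
  by case: ltngtP; rewrite ?andbT ?andbF.
case E: ((x \in A) == b).
  rewrite (big_pred1 x) // => y /=; rewrite !inE.
  by case: (eqVneq y x) => [->|_]; rewrite ?andbF //= E ltnSn.
rewrite big_pred0 // => y; rewrite !inE.
by case: (eqVneq y x) => [->|_]; rewrite ?andbF // E.
Qed.

Lemma leq_nbelow b A p q : (p <= q)%N -> (nbelow b A p <= nbelow b A q)%N.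
Proof.
move=> pq; apply/subset_leq_card/subsetP => x; rewrite !inE => /andP[-> /=].
by move=> xp; apply: leq_trans pq.
Qed.

Lemma nbelow_setC b A p : nbelow b (~: A) p = nbelow (~~ b) A p.
Proof. by apply: eq_card => x; rewrite !inE; case: (x \in A) b => -[]. Qed.

Lemma nbelow_seg b m p : (p <= k)%N ->
  nbelow b (seg m) p = if b then minn m p else (p - m)%N.
Proof.
elim: p => [|p IHp] lt_pk.
  rewrite /nbelow (_ : [set x | _] = set0) ?cards0; first by case: (b); lia.
  by apply/setP => x; rewrite !inE andbF.
rewrite (nbelowS b (seg m) (Ordinal lt_pk)) /= inE /= IHp; last exact: ltnW.
by case: (b); case: ltnP => /=; lia.
Qed.

Lemma weight_sw i A : lo i \notin A -> hi i \in A ->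
  weight A = (weight (sw i A)).+1.
Proof.
move=> loA hiA; rewrite /weight (bigD1 (hi i)) //=.
rewrite [in RHS](bigD1 (lo i)) ?mem_sw_lo //=; congr (_ + _).+1.
apply: eq_bigl => x; have [->|xhi] := eqVneq x (hi i).
  by rewrite andbF mem_sw_hi (negbTE loA).
have [->|xlo] := eqVneq x (lo i); first by rewrite (negbTE loA) andbF.
by rewrite !andbT (mem_sw_id A xlo xhi).
Qed.

Lemma card_seg m : (m <= k)%N -> #|seg m| = m.
Proof.
move=> /minn_idPl le_mk; rewrite -[RHS]le_mk -(nbelow_seg true) //.
by apply: eq_card => x; rewrite !inE ltn_ord andbT eqb_id.
Qed.

(** Without descents A is closed downwards, hence an initial segment. *)
Lemma no_descent_seg A : (forall i, hi i \in A -> lo i \in A) -> A = seg #|A|.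
Proof.
move=> Adown.
have Aclosed x y : x \in A -> (y <= x)%N -> y \in A.
  move Ed: (x - y)%N => d; elim: d x Ed => [|d IHd] x Ed Ax le_yx.
    by rewrite (_ : y = x) //; apply: val_inj => /=; lia.
  have lt_x : (x.-1 < k.-1)%N by have := ltn_ord x; lia.
  apply: (IHd (lo (Ordinal lt_x))) => /=; try lia.
  apply: Adown; rewrite (_ : hi _ = x) //; apply: val_inj => /=; lia.
apply/eqP; rewrite eqEcard card_seg ?leqnn ?andbT; last first.
  by rewrite -[X in (_ <= X)%N]card_ord; apply: max_card.
apply/subsetP => x Ax; rewrite inE -[X in (X <= _)%N]card_seg ?ltn_ord //.
by apply/subset_leq_card/subsetP => y; rewrite inE ltnS => /(Aclosed _ _ Ax).
Qed.

Lemma seg_or_descent m A : #|A| = m ->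
  A = seg m \/ exists2 i, lo i \notin A & hi i \in A.
Proof.
move=> Am; have [/existsP[i /andP[loA hiA]]|/existsPn Adown] :=
  boolP [exists i, (lo i \notin A) && (hi i \in A)]; first by right; exists i.
left; rewrite -Am; apply: no_descent_seg => i.
by have := Adown i; case: (lo i \in A) => //= /negbTE ->.
Qed.

(** Every m-subset is reached from the lowest one by steps that move one letter
    of the subset up by one. *)
Lemma subset_ind m (P : {set 'I_k} -> Prop) :
  P (seg m) ->
  (forall A i, #|A| = m -> lo i \in A -> hi i \notin A -> P A -> P (sw i A)) ->
  forall A, #|A| = m -> P A.
Proof.
move=> P0 PS A; move Ew: (weight A) => w.
elim: w A Ew => [|w IHw] A Ew Am.
  have [->//|[i loA hiA]] := seg_or_descent Am.
  by rewrite (weight_sw loA hiA) in Ew.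
have [->//|[i loA hiA]] := seg_or_descent Am.
rewrite -(swK i A); apply: PS; rewrite ?mem_sw_lo ?mem_sw_hi ?card_sw //.
apply: IHw; rewrite ?card_sw //.
by move: Ew; rewrite (weight_sw loA hiA) => -[].
Qed.

(** The same induction downwards from the highest subset. *)
Lemma subset_ind_co n (P : {set 'I_k} -> Prop) :
  P (~: seg n) ->
  (forall A i, #|~: A| = n -> lo i \notin A -> hi i \in A ->
     P A -> P (sw i A)) ->
  forall A, #|~: A| = n -> P A.
Proof.
move=> P0 PS A Am; rewrite -[A]setCK; move: Am.
apply: (subset_ind (P := fun C => P (~: C))) => // C i Cn loC hiC PC.
by rewrite -sw_setC; apply: PS; rewrite ?setCK ?inE ?loC.
Qed.

Lemma weight_max n A : #|~: A| = n ->
  A = ~: seg n \/ (weight A < weight (~: seg n))%N.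
Proof.
move: A; apply: subset_ind_co => [|A i An loA hiA IHA]; first by left.
right; have := weight_sw loA hiA; case: IHA => [->|]; lia.
Qed.

End Subsets.

Lemma card_setC_ord m n (A : {set 'I_(m + n)}) : #|A| = m -> #|~: A| = n.
Proof. by move=> Am; rewrite cardsCs setCK card_ord Am addKn. Qed.

(** * Ring elements attached to subsets *)

Section CosetElements.
Variables (k : nat) (Rg : pzRingType) (e : 'I_k.-1 -> Rg).
Implicit Types (i j : 'I_k.-1) (A : {set 'I_k}).

Hypothesis e_braid : forall i j, j = i.+1 :> nat ->
  e i * e j * e i = e j * e i * e j.
Hypothesis e_comm : forall i j, (i.+1 < j)%N -> e i * e j = e j * e i.

(** The weight drops by exactly one at each descent; so it is enough fuel, and
    the fuel left after one step is again the weight. *)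
Fixpoint coset_rec (n : nat) A : Rg :=
  if n is n'.+1 then
    if [pick i | (lo i \notin A) && (hi i \in A)] is Some i
    then e i * coset_rec n' (sw i A) else 1
  else 1.
Definition coset_elt A : Rg := coset_rec (weight A) A.

Lemma coset_elt_seg m : coset_elt (seg k m) = 1.
Proof.
rewrite /coset_elt; case: (weight _) => //= n; case: pickP => // i.
by rewrite !inE /= => /andP[]; lia.
Qed.

(** Descents i and i.+1 would need i.+1 both in A and outside A. *)
Lemma descents_far i j A : lo i \notin A -> hi i \in A ->
  lo j \notin A -> hi j \in A -> [\/ i = j, (i.+1 < j)%N | (j.+1 < i)%N].
Proof.
move=> li Hi lj hj.
case: (ltngtP i j) => [ij|ji|/val_inj]; last by constructor 1.
  constructor 2; rewrite ltn_neqAle ij andbT; apply: contraNneq lj => ij'.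
  by rewrite (@lo_next _ i).
constructor 3; rewrite ltn_neqAle ji andbT; apply: contraNneq li => ij'.
by rewrite (@lo_next _ j).
Qed.

(** The choice of the first descent does not matter: two distinct descents are
    far apart, so that their generators commute, and the diamond closes. *)
Lemma coset_elt_descent i A : lo i \notin A -> hi i \in A ->
  coset_elt A = e i * coset_elt (sw i A).
Proof.
move Ew: (weight A) => w; elim/ltn_ind: w A i Ew => w IHw A i Ew loA hiA.
have Ew1 := weight_sw loA hiA.
rewrite {1}/coset_elt Ew1 /=; case: pickP => [j /andP[ljA hjA]|]; last first.
  by move/(_ i); rewrite loA hiA.
have Ew2 := weight_sw ljA hjA.
rewrite (_ : weight (sw i A) = weight (sw j A)); last by lia.
rewrite -/(coset_elt (sw j A)).
have [->//|far] : i = j \/ (i.+1 < j)%N \/ (j.+1 < i)%N.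
  by case: (descents_far loA hiA ljA hjA); tauto.
have [lo1 hi1] : lo i \notin sw j A /\ hi i \in sw j A.
  by rewrite !mem_sw_id //=; lia.
have [lo2 hi2] : lo j \notin sw i A /\ hi j \in sw i A.
  by rewrite !mem_sw_id //=; lia.
rewrite (IHw _ _ (sw j A) i erefl) //; last by lia.
rewrite (IHw _ _ (sw i A) j erefl) //; last by lia.
by case: far => ij; rewrite !mulrA (e_comm ij) (sw_far _ ij).
Qed.

Lemma coset_elt_ascent i A : lo i \in A -> hi i \notin A ->
  e i * coset_elt A = coset_elt (sw i A).
Proof.
move=> loA hiA; rewrite [RHS](@coset_elt_descent i) ?mem_sw_lo ?mem_sw_hi //.
by rewrite swK.
Qed.

(** If i and i.+1 are in the same class, then s_i w = w s_j for the coset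
    representative w of A, where j is a generator of the Young subgroup.  The
    induction on the weight peels off a descent j of A.  It commutes past e i
    unless it is adjacent to i; then two descents are peeled off, and the braid
    relation moves e i across both of them, turning it into e j. *)
Lemma coset_elt_flat m A i b : #|A| = m ->
  (lo i \in A) = b -> (hi i \in A) = b ->
  exists j : 'I_k.-1,
    [/\ j = (if b then nbelow b A i else m + nbelow b A i)%N :> nat,
        b = (j < m)%N, j.+1 != m & e i * coset_elt A = coset_elt A * e j].
Proof.
move=> Am; have le_mk : (m <= k)%N.
  by rewrite -Am -[k in leqRHS]card_ord max_card.
move Ew: (weight A) => w; elim/ltn_ind: w A i Ew Am => w IHw A i Ew Am loA hiA.
have [EA|[j ljA hjA]] := seg_or_descent Am.
  exists i; have := ltn_ord i.
  move: loA hiA; rewrite EA !inE /= coset_elt_seg mulr1 mul1r => <- hb lt_i.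
  split=> //; last first.
    by apply: contraTneq isT => im; move: hb; rewrite im ltnn; lia.
  by case: (ltnP i m) hb => im hb; rewrite nbelow_seg; lia.
have Ew1 := weight_sw ljA hjA.
have braid_step : e i * e j * e i = e j * e i * e j -> lo i \notin sw j A ->
    hi i \in sw j A -> let A2 := sw i (sw j A) in
    (lo j \in A2) = b -> (hi j \in A2) = b -> nbelow b A2 j = nbelow b A i ->
  exists j : 'I_k.-1,
    [/\ j = (if b then nbelow b A i else m + nbelow b A i)%N :> nat,
        b = (j < m)%N, j.+1 != m & e i * coset_elt A = coset_elt A * e j].
  move=> eij lo1 hi1 A2 lo2 hi2 <-; have Ew2 := weight_sw lo1 hi1.
  have [||||j' [Ej' bj' nj' Hj']] := IHw (weight A2) _ A2 j erefl.
  + by rewrite /A2; lia.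
  + by rewrite !card_sw.
  + by [].
  + by [].
  exists j'; split=> //.
  rewrite (coset_elt_descent ljA hjA) (coset_elt_descent lo1 hi1) -/A2.
  by rewrite !mulrA eij -!mulrA Hj' !mulrA.
have [ijE|far] : i = j.+1 :> nat \/
    j = i.+1 :> nat \/ ((i.+1 < j) || (j.+1 < i))%N.
  suff : (i : nat) <> j by lia.
  move/val_inj => Eij.
  by move: ljA; rewrite -Eij loA -hiA Eij hjA.
(* A meets {j, i, i.+1} in {i, i.+1}. *)
- have bT : b = true by rewrite -loA (lo_next ijE).
  rewrite {b}bT in loA hiA IHw braid_step *; apply: braid_step.
  + exact/esym/e_braid.
  + by rewrite (lo_next ijE) mem_sw_hi.
  + by rewrite mem_sw_id ?hiA //=; lia.
  + by rewrite mem_sw_id ?mem_sw_lo ?hjA //=; lia.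
  + by rewrite -(lo_next ijE) mem_sw_lo mem_sw_id ?hiA //=; lia.
  + rewrite !nbelow_sw; try lia.
    by rewrite [in RHS]ijE (nbelowS _ _ (lo j)) (negbTE ljA) addn0.
case: far => [jiE|far].
(* A meets {i, j, j.+1} in {j.+1}. *)
- have bF : b = false by rewrite -hiA -(lo_next jiE) (negbTE ljA).
  rewrite {b}bF in loA hiA IHw braid_step *; apply: braid_step.
  + exact: e_braid.
  + by rewrite mem_sw_id ?loA //=; lia.
  + by rewrite -(lo_next jiE) mem_sw_lo.
  + by rewrite (lo_next jiE) mem_sw_hi mem_sw_id ?loA //=; lia.
  + by rewrite mem_sw_id ?mem_sw_hi -?(lo_next jiE) ?(negbTE ljA) //=; lia.
  + rewrite [in LHS]jiE (nbelowS _ _ (lo i)) !nbelow_sw /=; try lia.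
    by rewrite mem_sw_lo -(lo_next jiE) mem_sw_lo hjA addn0.
have [||||j' [Ej' bj' nj' Hj']] := IHw (weight (sw j A)) _ (sw j A) i erefl.
+ by lia.
+ by rewrite card_sw.
+ by rewrite mem_sw_id //=; lia.
+ by rewrite mem_sw_id //=; lia.
exists j'; split=> //; first by rewrite Ej' nbelow_sw //; lia.
rewrite (coset_elt_descent ljA hjA) mulrA -[RHS]mulrA -Hj' mulrA.
by congr (_ * _); case/orP: far => /e_comm.
Qed.

End CosetElements.

(** * The coinduced action on families indexed by subsets *)

(** Here z true and z false are two families of operators on V that commute with
    each other, for the letters inside and outside of a subset.  A function from subsets to V
    stands for an element phi of a coinduced module, its value at A being that
    of phi at chi(p_C) for the complement C of A.  As pi_i phi takes the value
    of phi at chi(pi_i p_C) there, pi_i acts by the rules for pi_i p_C. *)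
Section CoinducedAction.
Variables (F : comNzRingType) (k : nat) (V : lmodType F).
Variable z : bool -> nat -> endo V.
Implicit Types (i j : 'I_k.-1) (A : {set 'I_k}).

Hypothesis z_idem : forall b r, z b r * z b r = z b r.
Hypothesis z_braid : forall b r,
  z b r * z b r.+1 * z b r = z b r.+1 * z b r * z b r.+1.
Hypothesis z_comm : forall b r s, (r.+1 < s)%N -> z b r * z b s = z b s * z b r.
Hypothesis z_cross : forall r s, z true r * z false s = z false s * z true r.

Local Notation W := {ffun {set 'I_k} -> V}.

Definition coind_fun i (f : W) : W := [ffun A : {set 'I_k} =>
  if (lo i \in A) == (hi i \in A) then
    z (lo i \in A) (nbelow (lo i \in A) A i) (f A)
  else if hi i \in A then f (sw i A) else f A].

Fact coind_fun_is_linear i : linear (coind_fun i).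
Proof.
move=> c f g; apply/ffunP => A; rewrite !ffunE.
by case: ifP => _; rewrite ?linearP //; case: ifP => _; rewrite ?ffunE.
Qed.
HB.instance Definition _ i := GRing.isLinear.Build F W W _
  (coind_fun i) (coind_fun_is_linear i).

Definition coind_gen i : endo W := endo_of (coind_fun i).

Lemma endo_mulE (U : lmodType F) (f g : endo U) u : (f * g) u = f (g u).
Proof. by []. Qed.

(** For the braid relation, i, i.+1 and i.+2 fall into two classes, and all
    eight cases compute once memberships and ranks in the transposed subsets
    are expressed through A. *)
Lemma coind_rel : hecke_rel coind_gen.
Proof.
have zI b r v : z b r (z b r v) = z b r v by rewrite -[LHS]endo_mulE z_idem.
have zB b r v : z b r (z b r.+1 (z b r v)) = z b r.+1 (z b r (z b r.+1 v)).
  by have /(congr1 (fun g : endo V => g v)) := z_braid b r.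
have zC b c r s v : b != c \/ (r.+1 < s)%N -> z b r (z c s v) = z c s (z b r v).
  rewrite -![z _ _ (z _ _ _)]endo_mulE; case: (eqVneq b c) => [-> [//|rs]|].
    by rewrite z_comm.
  by case: b c => -[] // _ _; rewrite z_cross.
split=> [i|i j ij|i j ij]; apply: endo_ext => f; apply/ffunP => A;
  rewrite /= !ffunE ?mem_sw_lo ?mem_sw_hi.
- case Ea: (lo i \in A); case Eb: (hi i \in A) => //=.
- have lj := lo_next ij.
  have m1 X : (hi i \in sw j X) = (hi j \in X) by rewrite -lj mem_sw_lo.
  have m2 X : (hi j \in sw j X) = (hi i \in X) by rewrite mem_sw_hi lj.
  have m3 X : (hi j \in sw i X) = (hi j \in X) by rewrite mem_sw_id //=; lia.
  have m4 X : (lo i \in sw j X) = (lo i \in X) by rewrite mem_sw_id //=; lia.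
  have c1 b X : nbelow b (sw i X) i = nbelow b X i by rewrite nbelow_sw //; lia.
  have c2 b X : nbelow b (sw j X) i = nbelow b X i by rewrite nbelow_sw //; lia.
  have c3 b X : nbelow b X j = (nbelow b X i + ((lo i \in X) == b))%N.
    by rewrite ij (nbelowS _ _ (lo i)).
  rewrite !lj !(mem_sw_lo, mem_sw_hi, m1, m2, m3, m4) !c3.
  rewrite !(mem_sw_lo, mem_sw_hi, m1, m2, m3, m4, c1, c2) !swK.
  case Ea: (lo i \in A); case Eb: (hi i \in A); case Ec: (hi j \in A) => /=;
    rewrite ?addn0 ?addn1 ?zB //.
  by rewrite lj Eb.
- have m1 X : (lo i \in sw j X) = (lo i \in X) by rewrite mem_sw_id //=; lia.
  have m2 X : (hi i \in sw j X) = (hi i \in X) by rewrite mem_sw_id //=; lia.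
  have m3 X : (lo j \in sw i X) = (lo j \in X) by rewrite mem_sw_id //=; lia.
  have m4 X : (hi j \in sw i X) = (hi j \in X) by rewrite mem_sw_id //=; lia.
  have c1 b X : nbelow b (sw j X) i = nbelow b X i by rewrite nbelow_sw //; lia.
  have c2 b X : nbelow b (sw i X) j = nbelow b X j by rewrite nbelow_sw //; lia.
  have ranks b : lo i \in A = b -> hi i \in A = b ->
      ((nbelow b A i).+1 < nbelow b A j)%N.
    move=> Ea Eb; have := leq_nbelow b A ij.
    by rewrite (nbelowS b A (hi i)) (nbelowS b A (lo i)) Ea Eb eqxx /=; lia.
  rewrite !(m1, m2, m3, m4, c1, c2) (sw_far _ ij).
  case Ea: (lo i \in A); case Eb: (hi i \in A);
  case Ec: (lo j \in A); case Ed: (hi j \in A) => //=; apply: zC;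
  by [left | right; apply: ranks].
Qed.

End CoinducedAction.

(** * Generation of the algebras, and generators acting on tensor products *)

Lemma additive0 (U V : zmodType) (f : U -> V) :
  {morph f : x y / x + y} -> f 0 = 0.
Proof. by move=> fD; apply: (addrI (f 0)); rewrite -fD !addr0. Qed.

Lemma additive_sum (U V : zmodType) (f : U -> V) (I : finType) (P : pred I)
    (g : I -> U) :
  {morph f : x y / x + y} -> f (\sum_(i | P i) g i) = \sum_(i | P i) f (g i).
Proof. by move=> fD; apply: (big_morph f fD (additive0 fD)). Qed.

Lemma mod_iso_of_cancel (A : pzRingType) (V W : lmodType A)
    (f : V -> W) (g : W -> V) :
  linear f -> cancel f g -> cancel g f -> mod_iso V W.
Proof.
move=> f_lin fK gK.
pose fL := GRing.isLinear.Build A V W _ f f_lin.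
pose F : {linear V -> W} := HB.pack f fL.
by exists F; exists g.
Qed.

(** An additive inverse is a product with the scalar -1, so that closure under
    opposites follows. *)
Lemma hecke_gen_ind (F : comNzRingType) (k : nat) (S : hecke F k -> Prop) :
  (forall c, S c%:A) -> (forall i, S (hpi F i)) ->
  (forall x y, S x -> S y -> S (x + y)) ->
  (forall x y, S x -> S y -> S (x * y)) -> forall x, S x.
Proof.
move=> Sc Sg SD SM; elim/hecke_ind.
elim=> [i|||x Sx y Sy|x Sx|x Sx y Sy|c x Sx].
- exact: Sg.
- by have := Sc 0; rewrite scale0r.
- by have := Sc 1; rewrite scale1r.
- by rewrite -hecke_addE; apply: SD.
- rewrite -hecke_oppE -[hecke_opp _]/(- hclass x) -mulN1r -scaleN1r.
  exact: SM.
- by rewrite -hecke_mulE; apply: SM.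
- rewrite -hecke_scaleE -[hecke_scale _ _]/(c *: hclass x) -mulr_algl.
  exact: SM.
Qed.

Lemma parab_gen_ind (F : comNzRingType) (k a : nat) (S : parab F k a -> Prop) :
  (forall c, S c%:A) ->
  (forall (i : 'I_k.-1) (b : parab F k a),
     i.+1 != a -> parab_val b = hpi F i -> S b) ->
  (forall x y, S x -> S y -> S (x + y)) ->
  (forall x y, S x -> S y -> S (x * y)) -> forall x, S x.
Proof.
move=> Sc Sg SD SM [x px].
pose Q : {pred hecke F k} :=
  fun y => `[< exists2 b : parab F k a, parab_val b = y & S b >].
have [Q1 QL QM] : subalg_closed Q.
  split=> [|c _ _ /asboolP[x' <- Sx'] /asboolP[y' <- Sy']
          |_ _ /asboolP[x' <- Sx'] /asboolP[y' <- Sy']]; apply/asboolP.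
  - by exists 1 => //; have := Sc 1; rewrite scale1r.
  - exists (c%:A * x' + y'); last by apply: SD => //; apply: SM.
    by rewrite mulr_algl.
  - by exists (x' * y') => //; apply: SM.
have /asboolP[b bx Sb] : x \in Q.
  apply: (gensub_min _ _ px) => // _ [i ia ->].
  have pi_in : hpi F i \in gensub (@parab_gen F k a).
    by apply: gensub_gen; exists i.
  by apply/asboolP; exists (Parab pi_in) => //; apply: (Sg i).
by rewrite (_ : Parab px = b) //; apply: val_inj.
Qed.

Lemma parab_generator (F : comNzRingType) (k a : nat) (i : 'I_k.-1) :
  i.+1 != a -> exists b : parab F k a, parab_val b = hpi F i.
Proof.
move=> ia; have pi_in : hpi F i \in gensub (@parab_gen F k a).
  by apply: gensub_gen; exists i.
by exists (Parab pi_in).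
Qed.

Section OuterTensor.
Variables (F : comNzRingType) (a b : nat).
Variables (M : lmodType (hecke F a)) (N : lmodType (hecke F b)).
Local Notation T := (tens (vspaceof M) (vspaceof N)).

(** The operator pi_r (x) 1 or 1 (x) pi_r, extended by 0 to all r.  In this
    form both families satisfy the relations of a 0-Hecke algebra without any
    bound on the indices. *)
Definition factor_gen (l : bool) (r : nat) : endo T :=
  if l then
    if insub r is Some j then endo_of (tmap (lact (hpi F (j : 'I_a.-1))) idfun)
    else 0
  else
    if insub r is Some j then endo_of (tmap idfun (lact (hpi F (j : 'I_b.-1))))
    else 0.

Lemma factor_gen_idem l r : factor_gen l r * factor_gen l r = factor_gen l r.
Proof.
have [ai _ _] := hpi_rel F a; have [bi _ _] := hpi_rel F b.
rewrite /factor_gen; case: l; case: insubP => [j _ _|_]; rewrite ?mul0r //.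
  by apply: endo_tens_ext => u w; rewrite /= !tmap_pure /= lactM ai.
by apply: endo_tens_ext => u w; rewrite /= !tmap_pure /= lactM bi.
Qed.

Lemma factor_gen_braid l r :
  factor_gen l r * factor_gen l r.+1 * factor_gen l r
    = factor_gen l r.+1 * factor_gen l r * factor_gen l r.+1.
Proof.
have [_ ab _] := hpi_rel F a; have [_ bb _] := hpi_rel F b.
rewrite /factor_gen; case: l.
all: case: insubP => [i _ Ei|_]; last by rewrite !(mul0r, mulr0).
all: case: insubP => [j _ Ej|_]; last by rewrite !(mul0r, mulr0).
  apply: endo_tens_ext => u w; rewrite /= !tmap_pure /= !lactM ab //.
  by rewrite Ei Ej.
apply: endo_tens_ext => u w; rewrite /= !tmap_pure /= !lactM bb //.
by rewrite Ei Ej.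
Qed.

Lemma factor_gen_comm l r s : (r.+1 < s)%N ->
  factor_gen l r * factor_gen l s = factor_gen l s * factor_gen l r.
Proof.
have [_ _ ac] := hpi_rel F a; have [_ _ bc] := hpi_rel F b.
move=> rs; rewrite /factor_gen; case: l.
all: case: insubP => [i _ Ei|_]; last by rewrite !(mul0r, mulr0).
all: case: insubP => [j _ Ej|_]; last by rewrite !(mul0r, mulr0).
  apply: endo_tens_ext => u w; rewrite /= !tmap_pure /= !lactM ac //.
  by rewrite Ei Ej.
apply: endo_tens_ext => u w; rewrite /= !tmap_pure /= !lactM bc //.
by rewrite Ei Ej.
Qed.

Lemma factor_gen_cross r s :
  factor_gen true r * factor_gen false s
    = factor_gen false s * factor_gen true r.
Proof.
rewrite /factor_gen; case: insubP => [i _ Ei|_]; last by rewrite mul0r mulr0.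
case: insubP => [j _ Ej|_]; last by rewrite mul0r mulr0.
by apply: endo_tens_ext => u w; rewrite /= !tmap_pure.
Qed.

Lemma mtens_gen_factor k (i : 'I_k.-1) : i.+1 != a ->
  mtens_gen M N i
    = factor_gen (i < a)%N (if (i < a)%N then i : nat else (i - a)%N).
Proof.
move=> ia; rewrite /mtens_gen /split_idx (negbTE ia) /factor_gen.
have -> : (i.+1 < a)%N = (i < a)%N by lia.
by case: ifP => _; case: insubP.
Qed.

Lemma mtens_scalar k c (t : mtens k M N) :
  (c%:A : parab F k a) *: t = c *: (t : T).
Proof.
rewrite mtensE /mtens_morphism /= hlift_scale.
have -> : hlift (@endo_scalarC F T) (mtens_rel k M N) 1 = 1 by apply: rmorph1.
by rewrite mulr1.
Qed.

Lemma mtens_generator k (i : 'I_k.-1) (x : parab F k a) (t : mtens k M N) :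
  parab_val x = hpi F i -> x *: t = mtens_gen M N i (t : T).
Proof. by move=> xi; rewrite mtensE xi /mtens_morphism /= hlift_hpi. Qed.

End OuterTensor.

(** * Maps out of the induction product *)

Section InducedLift.
Variables (B A : pzRingType) (iota : {rmorphism B -> A}) (V : lmodType B).

Lemma ipure_bal (x : A) (b : B) (v : V) :
  ipure iota (x * iota b) v = ipure iota x (b *: v).
Proof. exact: pure_bal. Qed.

Variables (G : zmodType) (f : A -> V -> G).

Definition ilift (y : induced iota V) : G := tlift f y.

Hypotheses (fDl : forall v, {morph f^~ v : x y / x + y})
  (fDr : forall x, {morph f x : v w / v + w})
  (fB : forall x b v, f (x * iota b) v = f x (b *: v)).

Fact ilift_balanced : balanced (fun (x : A) (b : B) => x * iota b)
  (fun (b : B) (v : V) => b *: v) f.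
Proof. by split. Qed.

Lemma ilift_pure x v : ilift (ipure iota x v) = f x v.
Proof. exact: tlift_pure ilift_balanced x v. Qed.
Lemma iliftD : {morph ilift : s t / s + t}.
Proof. exact: tliftD ilift_balanced. Qed.

End InducedLift.

Section Boxtimes.
Variables (F : comNzRingType) (k a b : nat).
Variables (M : lmodType (hecke F a)) (N : lmodType (hecke F b)).
Local Notation H := (hecke F k).
Local Notation T := (tens (vspaceof M) (vspaceof N)).

Definition bpure (x : H) (t : T) : boxtimes k M N :=
  ipure (parab_incl F k a) x (t : mtens k M N).

Lemma bpureDl t : {morph bpure^~ t : x y / x + y}.
Proof. by move=> x y; apply: pureDl. Qed.
Lemma bpureDr x : {morph bpure x : s t / s + t}.
Proof. by move=> s t; apply: pureDr. Qed.
Lemma bpure_act (c x : H) t : c *: bpure x t = bpure (c * x) t.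
Proof. exact: induced_scale_pure. Qed.

Lemma bpure_gen x (i : 'I_k.-1) t : i.+1 != a ->
  bpure (x * hpi F i) t = bpure x (mtens_gen M N i t).
Proof.
move=> /(@parab_generator F) [p Ep]; rewrite -Ep /bpure.
rewrite -(mtens_generator t Ep).
exact: (ipure_bal (parab_incl F k a)).
Qed.

Lemma bpure_scalar x c t : bpure (x * c%:A) t = bpure x (c *: t).
Proof.
rewrite /bpure -mtens_scalar -ipure_bal.
by congr (ipure _ (_ * _) _).
Qed.

Lemma boxtimes_ext (G : zmodType) (f g : boxtimes k M N -> G) :
  {morph f : s t / s + t} -> {morph g : s t / s + t} ->
  (forall x t, f (bpure x t) = g (bpure x t)) -> f =1 g.
Proof. exact: tensor_ext. Qed.

Section Lift.
Variables (G : zmodType) (f : H -> T -> G).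

(** Balancedness reduced to scalars and to the generators of the parabolic
    subalgebra. *)
Definition bbalanced : Prop :=
  [/\ forall t, {morph f^~ t : x y / x + y},
      forall x, {morph f x : s t / s + t},
      forall x c t, f (x * c%:A) t = f x (c *: t)
    & forall x (i : 'I_k.-1) t, i.+1 != a ->
        f (x * hpi F i) t = f x (mtens_gen M N i t)].

Definition blift (y : boxtimes k M N) : G :=
  @ilift _ _ (parab_incl F k a) (mtens k M N) G f y.

Hypothesis fP : bbalanced.

Fact blift_act x (p : parab F k a) (t : mtens k M N) :
  f (x * parab_incl F k a p) t = f x (p *: t).
Proof.
case: fP => fDl fDr fc fg; move: p x t.
apply: parab_gen_ind => [c x t|i p ia Ep x t|p q Hp Hq x t|p q Hp Hq x t].
- by rewrite mtens_scalar -fc.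
- by rewrite (mtens_generator t Ep) -fg // -Ep.
- by rewrite scalerDl rmorphD mulrDr fDl Hp Hq fDr.
- by rewrite rmorphM mulrA Hq Hp scalerA.
Qed.

Lemma blift_pure x t : blift (bpure x t) = f x t.
Proof.
by case: fP => fDl fDr _ _; apply: ilift_pure => //; apply: blift_act.
Qed.
Lemma bliftD : {morph blift : s t / s + t}.
Proof. by case: fP => fDl fDr _ _; apply: iliftD => //; apply: blift_act. Qed.

End Lift.
End Boxtimes.

Arguments bpure {F k a b} M N x t.

(** The map a (x) t |-> beta(a) (x) s(t), for a map s that intertwines the
    generators of the parabolic subalgebra with their images under beta.  That
    these images lie in the other parabolic subalgebra is implicit in
    [twist_compatible], which moves them across the tensor sign. *)
Section BoxtimesTwist.
Variables (F : comNzRingType) (k a b a' b' : nat).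
Variables (M : lmodType (hecke F a)) (N : lmodType (hecke F b)).
Variables (M' : lmodType (hecke F a')) (N' : lmodType (hecke F b')).
Variable beta : {lrmorphism hecke F k -> hecke F k}.
Local Notation T := (tens (vspaceof M) (vspaceof N)).
Local Notation T' := (tens (vspaceof M') (vspaceof N')).
Variable s : T -> T'.

Definition twist_compatible : Prop :=
  [/\ {morph s : t u / t + u},
      forall (c : F) t, s (c *: t) = c *: s t
    & forall x (i : 'I_k.-1) t, i.+1 != a ->
        bpure M' N' (x * beta (hpi F i)) (s t)
          = bpure M' N' x (s (mtens_gen M N i t))].

Definition twist_map : boxtimes k M N -> boxtimes k M' N' :=
  blift (fun x t => bpure M' N' (beta x) (s t)).

Hypothesis sP : twist_compatible.

Fact twist_balanced : bbalanced (fun x t => bpure M' N' (beta x) (s t)).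
Proof.
case: sP => sD sZ sg; split=> [t x y|x t u|x c t|x i t ia].
- by rewrite rmorphD bpureDl.
- by rewrite sD bpureDr.
- by rewrite rmorphM /= linearZ rmorph1 bpure_scalar sZ.
- by rewrite rmorphM sg.
Qed.

Lemma twist_map_pure x t :
  twist_map (bpure M N x t) = bpure M' N' (beta x) (s t).
Proof. exact: blift_pure twist_balanced x t. Qed.
Lemma twist_mapD : {morph twist_map : u v / u + v}.
Proof. exact: bliftD twist_balanced. Qed.

Lemma twist_map_act c y : twist_map (c *: y) = beta c *: twist_map y.
Proof.
move: y; apply: boxtimes_ext => [u v|u v|x t].
- by rewrite scalerDr twist_mapD.
- by rewrite twist_mapD scalerDr.
by rewrite bpure_act !twist_map_pure rmorphM bpure_act.
Qed.

End BoxtimesTwist.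

Lemma boxtimes_twist_iso (F : comNzRingType) (k a b a' b' : nat)
    (M : lmodType (hecke F a)) (N : lmodType (hecke F b))
    (M' : lmodType (hecke F a')) (N' : lmodType (hecke F b'))
    (beta : {lrmorphism hecke F k -> hecke F k})
    (s : tens (vspaceof M) (vspaceof N) -> tens (vspaceof M') (vspaceof N'))
    (s' : tens (vspaceof M') (vspaceof N') -> tens (vspaceof M) (vspaceof N)) :
  involutive beta -> cancel s s' -> cancel s' s ->
  twist_compatible beta s -> twist_compatible beta s' ->
  mod_iso (pullback beta (boxtimes k M N)) (boxtimes k M' N').
Proof.
move=> betaK sK s'K sP s'P.
apply: (@mod_iso_of_cancel _ (pullback beta (boxtimes k M N)) (boxtimes k M' N')
  (twist_map beta s) (twist_map beta s')).
- move=> c u v; rewrite (twist_mapD sP); congr (_ + _).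
  by rewrite [LHS](twist_map_act sP) betaK.
- apply: boxtimes_ext => [u v|u v //|x t].
    by rewrite (twist_mapD sP) (twist_mapD s'P).
  by rewrite (twist_map_pure sP) (twist_map_pure s'P) betaK sK.
- apply: boxtimes_ext => [u v|u v //|x t].
    by rewrite (twist_mapD s'P) (twist_mapD sP).
  by rewrite (twist_map_pure s'P) (twist_map_pure sP) betaK s'K.
Qed.

Lemma hphiK (F : comNzRingType) k : involutive (hphi F k).
Proof.
pose f := (hphi F k \o hphi F k : {lrmorphism _ -> _}).
apply: (@hecke_lrmorphism_ext _ _ _ f idfun) => i.
by rewrite /= !hphi_hpi rev_ordK.
Qed.

Lemma hthetaK (F : comNzRingType) k : involutive (htheta F k).
Proof.
pose f := (htheta F k \o htheta F k : {lrmorphism _ -> _}).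
apply: (@hecke_lrmorphism_ext _ _ _ f idfun) => i.
rewrite /= htheta_hpi rmorphN rmorphB rmorph1 /= htheta_hpi /hpibar.
by rewrite !opprB addrC subrK.
Qed.

Section TensLift.
Variables (F : comNzRingType) (U W : lmodType F).

Lemma tens_lift (G : lmodType F) (f : U -> W -> G) :
  (forall w, linear (f^~ w)) -> (forall u, linear (f u)) ->
  { g : tens U W -> G | [/\ forall u w, g (tpure u w) = f u w,
     {morph g : s t / s + t} & forall c t, g (c *: t) = c *: g t] }.
Proof.
move=> fl fr.
have flD w : {morph f^~ w : u v / u + v}.
  by move=> u v; have := fl w 1 u v; rewrite !scale1r.
have frD u : {morph f u : v w / v + w}.
  by move=> v w; have := fr u 1 v w; rewrite !scale1r.
have flZ c u w : f (c *: u) w = c *: f u w.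
  by have := fl w c u 0; rewrite (additive0 (flD w)) !addr0.
have bal : balanced (fun (u : U) (c : F) => c *: u) (fun c (w : W) => c *: w) f.
  split=> // u c w; have := fr u c w 0.
  by rewrite (additive0 (frD u)) !addr0 flZ.
have liftp u w : tlift f (tpure u w) = f u w by apply: tlift_pure bal u w.
exists (tlift f : tens U W -> G); split=> [//||c]; first exact: tliftD bal.
apply: tens_ext => [s t|s t|u w].
- by rewrite scalerDr (tliftD bal).
- by rewrite (tliftD bal) scalerDr.
by rewrite tens_scale_pure !liftp.
Qed.

End TensLift.

(** * Twisting by phi and theta *)

Section MtensGen.
Variables (F : comNzRingType) (k a b : nat).
Variables (M : lmodType (hecke F a)) (N : lmodType (hecke F b)).

Lemma mtens_gen_left (i : 'I_k.-1) (j : 'I_a.-1)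
    (u : vspaceof M) (w : vspaceof N) :
  i = j :> nat -> mtens_gen M N i (tpure u w) = tpure (lact (hpi F j) u) w.
Proof. by move=> ij; rewrite /mtens_gen ij split_idx_left /= tmap_pure. Qed.

Lemma mtens_gen_right (i : 'I_k.-1) (j : 'I_b.-1)
    (u : vspaceof M) (w : vspaceof N) :
  i = (a + j)%N :> nat ->
  mtens_gen M N i (tpure u w) = tpure u (lact (hpi F j) w).
Proof. by move=> ij; rewrite /mtens_gen ij split_idx_right /= tmap_pure. Qed.

End MtensGen.

Lemma parab_index a b (i : 'I_(a + b).-1) : i.+1 != a ->
  (exists j : 'I_a.-1, i = j :> nat) \/
  (exists j : 'I_b.-1, i = (a + j)%N :> nat).
Proof.
move=> ia; have := ltn_ord i.
have [lt_ia|le_ai] := ltnP i a => lt_i; [left|right].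
  have lt_j : (i < a.-1)%N by lia.
  by exists (Ordinal lt_j).
have lt_j : (i - a < b.-1)%N by lia.
by exists (Ordinal lt_j); rewrite /=; lia.
Qed.

(** The identity map is semilinear both from V to the twist of V and back.
    Stating the next lemmas for semilinear maps gives the isomorphism and its
    inverse at once. *)
Definition semilinear (F : comNzRingType) (k : nat)
    (beta : {lrmorphism hecke F k -> hecke F k}) (M M' : lmodType (hecke F k))
    (e : M -> M') : Prop :=
  {morph e : u v / u + v} /\ forall h u, e (h *: u) = beta h *: e u.

Lemma semilinear_to_pullback (F : comNzRingType) (k : nat)
    (beta : {lrmorphism hecke F k -> hecke F k}) (M : lmodType (hecke F k)) :
  involutive beta -> semilinear beta (id : M -> pullback beta M).
Proof.
by move=> betaK; split=> // h u; rewrite -[RHS]/(beta (beta h) *: u) betaK.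
Qed.

Lemma semilinear_of_pullback (F : comNzRingType) (k : nat)
    (beta : {lrmorphism hecke F k -> hecke F k}) (M : lmodType (hecke F k)) :
  semilinear beta (id : pullback beta M -> M).
Proof. by []. Qed.

Lemma semilinear_linear (F : comNzRingType) (k : nat)
    (beta : {lrmorphism hecke F k -> hecke F k}) (M M' : lmodType (hecke F k))
    (e : M -> M') :
  semilinear beta e -> linear (e : vspaceof M -> vspaceof M').
Proof.
move=> [eD eZ] c u v; rewrite [LHS]eD; congr (_ + _).
by rewrite [LHS]eZ /= linearZ rmorph1.
Qed.

Section TensorMaps.
Variables (F : comNzRingType) (U W U' W' : lmodType F).
Variables (e : U -> U') (g : W -> W').
Hypotheses (el : linear e) (gl : linear g).

Lemma tens_map2 : { h : tens U W -> tens U' W' |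
  [/\ forall u w, h (tpure u w) = tpure (e u) (g w),
      {morph h : s t / s + t} & forall c t, h (c *: t) = c *: h t] }.
Proof.
apply: tens_lift => [w c u v|u c v w].
  by rewrite el tpureDl tens_scale_pure.
by rewrite gl tpureDr tens_scale_pure tpure_bal.
Qed.

Lemma tens_flip : { h : tens U W -> tens W' U' |
  [/\ forall u w, h (tpure u w) = tpure (g w) (e u),
      {morph h : s t / s + t} & forall c t, h (c *: t) = c *: h t] }.
Proof.
apply: tens_lift => [w c u v|u c v w].
  by rewrite el tpureDr tens_scale_pure tpure_bal.
by rewrite gl tpureDl tens_scale_pure.
Qed.

End TensorMaps.

Section Phi.
Variables (F : comNzRingType) (k m n : nat) (Ek : k = (m + n)%N).
Variables (M M' : lmodType (hecke F m)) (N N' : lmodType (hecke F n)).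

(** The reversal of the indices of H_(m+n)(0) induces on each of the factors
    the reversal of its own indices, and exchanges the factors. *)
Lemma phi_flip (e : M -> M') (g : N -> N') :
  semilinear (hphi F m) e -> semilinear (hphi F n) g ->
  { s : tens (vspaceof M) (vspaceof N) -> tens (vspaceof N') (vspaceof M') |
    (forall u w, s (tpure (u : vspaceof M) (w : vspaceof N))
       = tpure (g w : vspaceof N') (e u : vspaceof M')) /\
    twist_compatible (hphi F k) s }.
Proof.
move=> eP gP.
have [s [sE sD sZ]] := tens_flip (semilinear_linear eP) (semilinear_linear gP).
exists s; split=> //; split=> // x i t im; rewrite hphi_hpi.
move: t; apply: tens_ext => [t t'|t t'|u w].
- by rewrite sD bpureDr.
- by rewrite linearD sD bpureDr.
rewrite bpure_gen; last by move: im (ltn_ord i) => /=; lia.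
congr bpure; move: i im; rewrite Ek => i im.
case: (parab_index im) => -[j ij].
  rewrite (mtens_gen_left _ _ ij) !sE (mtens_gen_right (j := rev_ord j)) /=.
    by congr tpure; rewrite [RHS](proj2 eP) hphi_hpi.
  by have := ltn_ord j; lia.
rewrite (mtens_gen_right _ _ ij) !sE (mtens_gen_left (j := rev_ord j)) /=.
  by congr tpure; rewrite [RHS](proj2 gP) hphi_hpi.
by have := ltn_ord j; lia.
Qed.

End Phi.

Section Theta.
Variables (F : comNzRingType) (k m n : nat) (Ek : k = (m + n)%N).
Variables (M M' : lmodType (hecke F m)) (N N' : lmodType (hecke F n)).

(** Both sides come down to 1 - pi_i acting on one of the factors. *)
Lemma theta_keep (e : M -> M') (g : N -> N') :
  semilinear (htheta F m) e -> semilinear (htheta F n) g ->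
  { s : tens (vspaceof M) (vspaceof N) -> tens (vspaceof M') (vspaceof N') |
    (forall u w, s (tpure (u : vspaceof M) (w : vspaceof N))
       = tpure (e u : vspaceof M') (g w : vspaceof N')) /\
    twist_compatible (htheta F k) s }.
Proof.
move=> eP gP.
have [s [sE sD sZ]] := tens_map2 (semilinear_linear eP) (semilinear_linear gP).
exists s; split=> //; split=> // x i t im; rewrite htheta_hpi.
rewrite /hpibar opprB mulrBr mulr1.
have -> : bpure M' N' (x - x * hpi F i) (s t)
    = bpure M' N' x (s t - mtens_gen M' N' i (s t)).
  apply: (addIr (bpure M' N' (x * hpi F i) (s t))).
  by rewrite -bpureDl subrK bpure_gen // -bpureDr subrK.
congr bpure; move: t; apply: tens_ext => [t t'|t t'|u w].
- by rewrite sD linearD opprD addrACA.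
- by rewrite linearD sD.
apply: (addIr (mtens_gen M' N' i (s (tpure u w)))); rewrite subrK.
move: i im; rewrite Ek => i im; case: (parab_index im) => -[j ij].
  rewrite (mtens_gen_left _ _ ij) !sE (mtens_gen_left _ _ ij) -tpureDl.
  congr tpure; rewrite [X in X + _](proj2 eP) htheta_hpi /hpibar opprB.
  by rewrite scalerBl scale1r; apply/esym/subrK.
rewrite (mtens_gen_right _ _ ij) !sE (mtens_gen_right _ _ ij) -tpureDr.
congr tpure; rewrite [X in X + _](proj2 gP) htheta_hpi /hpibar opprB.
by rewrite scalerBl scale1r; apply/esym/subrK.
Qed.

End Theta.

Lemma boxtimes_phi (F : comNzRingType) (m n : nat)
    (M : lmodType (hecke F m)) (N : lmodType (hecke F n)) :
  mod_iso (phi_twist (boxtimes (m + n) M N))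
          (boxtimes (m + n) (phi_twist N) (phi_twist M)).
Proof.
have toM := semilinear_to_pullback M (@hphiK F m).
have toN := semilinear_to_pullback N (@hphiK F n).
have ofM := semilinear_of_pullback (hphi F m) M.
have ofN := semilinear_of_pullback (hphi F n) N.
have [s [sE sP]] := phi_flip erefl toM toN.
have [s' [s'E s'P]] := phi_flip (addnC m n) ofN ofM.
have [_ [sD _ _] [s'D _ _]] := And3 I sP s'P.
apply: (boxtimes_twist_iso (@hphiK F (m + n)) _ _ sP s'P).
  apply: tens_ext => [t t'|//|u w]; first by rewrite sD s'D.
  by rewrite sE s'E.
apply: tens_ext => [t t'|//|u w]; first by rewrite s'D sD.
by rewrite s'E sE.
Qed.

Lemma boxtimes_theta (F : comNzRingType) (m n : nat)
    (M : lmodType (hecke F m)) (N : lmodType (hecke F n)) :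
  mod_iso (theta_twist (boxtimes (m + n) M N))
          (boxtimes (m + n) (theta_twist M) (theta_twist N)).
Proof.
have toM := semilinear_to_pullback M (@hthetaK F m).
have toN := semilinear_to_pullback N (@hthetaK F n).
have ofM := semilinear_of_pullback (htheta F m) M.
have ofN := semilinear_of_pullback (htheta F n) N.
have [s [sE sP]] := theta_keep erefl toM toN.
have [s' [s'E s'P]] := theta_keep erefl ofM ofN.
have [_ [sD _ _] [s'D _ _]] := And3 I sP s'P.
apply: (boxtimes_twist_iso (@hthetaK F (m + n)) _ _ sP s'P).
  apply: tens_ext => [t t'|//|u w]; first by rewrite sD s'D.
  by rewrite sE s'E.
apply: tens_ext => [t t'|//|u w]; first by rewrite s'D sD.
by rewrite s'E sE.
Qed.

(** * The dual of an outer tensor product *)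

Section Pairing.
Variables (F : comNzRingType) (m n : nat).
Variables (M : lmodType (hecke F m)) (N : lmodType (hecke F n)).
Local Notation T := (tens (vspaceof M) (vspaceof N)).
Local Notation DM := (dual (hchi F m) M).
Local Notation DN := (dual (hchi F n) N).
Local Notation T' := (tens (vspaceof (chi_twist N)) (vspaceof (chi_twist M))).

Lemma dual_scalar k (V : lmodType (hecke F k)) (d : dual (hchi F k) V) c v :
  d (c%:A *: v) = c * d v.
Proof.
have d0 : d 0 = 0 by apply: additive0 (dualD d).
by have := dualE d c v 0; rewrite d0 !addr0.
Qed.

Lemma chi_scalar k (V : lmodType (hecke F k)) (c : F)
    (d : vspaceof (chi_twist V)) v :
  (c *: d : dual (hchi F k) V) v = c * (d : dual (hchi F k) V) v.
Proof.
rewrite -[LHS]/((d : dual (hchi F k) V) ((hchi F k c%:A : hecke F k) *: v)).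
by rewrite linearZ rmorph1 dual_scalar.
Qed.

Lemma pairing_pure (d : DN) (e : DM) : { f : T -> F^o |
  [/\ forall u w, f (tpure u w) = e u * d w,
      {morph f : s t / s + t} & forall c t, f (c *: t) = c *: f t] }.
Proof.
apply: tens_lift => [w c u v|u c v w].
  by rewrite [e _](dualP e c u v) mulrDl -[in LHS]mulrA.
rewrite [d _](dualP d c v w) mulrDr; congr (_ + _).
by rewrite [LHS]mulrCA.
Qed.

Definition pairing1 d e : T -> F := sval (pairing_pure d e).

Lemma pairing1E d e u w : pairing1 d e (tpure u w) = e u * d w.
Proof. by rewrite /pairing1; case: pairing_pure => f [/= ->]. Qed.
Lemma pairing1D d e : {morph pairing1 d e : s t / s + t}.
Proof. by rewrite /pairing1; case: pairing_pure => f []. Qed.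
Lemma pairing1Z d e c t : pairing1 d e (c *: t) = c * pairing1 d e t.
Proof. by rewrite /pairing1; case: pairing_pure => f [/= _ _ ->]. Qed.

Lemma pairing_sig (t : T) : { f : T' -> F^o |
  [/\ forall d e, f (tpure d e) = pairing1 d e t,
      {morph f : s t / s + t} & forall c t, f (c *: t) = c *: f t] }.
Proof.
apply: tens_lift => [e c d d'|d c e e']; move: t.
  apply: tens_ext => [s t|s t|u w].
  - by rewrite pairing1D.
  - by rewrite !pairing1D scalerDr addrACA.
  by rewrite !pairing1E dual_addE chi_scalar mulrDr mulrCA.
apply: tens_ext => [s t|s t|u w].
- by rewrite pairing1D.
- by rewrite !pairing1D scalerDr addrACA.
by rewrite !pairing1E dual_addE chi_scalar mulrDl -[in LHS]mulrA.
Qed.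

(** The map from N^* (x) M^* to the dual of M (x) N, as a bilinear form. *)
Definition pairing (t' : T') (t : T) : F := sval (pairing_sig t) t'.

Lemma pairingE (d : DN) (e : DM) u w :
  pairing (tpure (d : vspaceof (chi_twist N)) (e : vspaceof (chi_twist M)))
      (tpure u w) = e u * d w.
Proof.
by rewrite /pairing; case: pairing_sig => f [/= ->]; rewrite pairing1E.
Qed.
Lemma pairingDl t : {morph pairing^~ t : s' t' / s' + t'}.
Proof. by rewrite /pairing; case: pairing_sig => f []. Qed.
Lemma pairingZl c t' t : pairing (c *: t') t = c * pairing t' t.
Proof. by rewrite /pairing; case: pairing_sig => f [/= _ _ ->]. Qed.

Lemma pairing_tpure d e t : pairing (tpure d e) t = pairing1 d e t.
Proof. by rewrite /pairing; case: pairing_sig => f [/= ->]. Qed.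

Lemma pairingDr t' : {morph pairing t' : s t / s + t}.
Proof.
move=> s t; move: t'; apply: tens_ext => [r' s'|r' s'|d e].
- by rewrite pairingDl.
- by rewrite !pairingDl addrACA.
by rewrite !pairing_tpure pairing1D.
Qed.
Lemma pairingZr c t' t : pairing t' (c *: t) = c * pairing t' t.
Proof.
move: t'; apply: tens_ext => [r' s'|r' s'|d e].
- by rewrite pairingDl.
- by rewrite !pairingDl mulrDr.
by rewrite !pairing_tpure pairing1Z.
Qed.

Lemma pairing_factor_gen l r t' t :
  pairing (factor_gen (chi_twist N) (chi_twist M) (~~ l) r t') t
    = pairing t' (factor_gen M N l r t).
Proof.
move: t'; apply: tens_ext => [r' s'|r' s'|d e].
- by rewrite linearD pairingDl.
- by rewrite pairingDl.
move: t; apply: tens_ext => [s t|s t|u w].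
- by rewrite pairingDr.
- by rewrite linearD pairingDr.
have p0l s : pairing 0 s = 0 by apply: additive0 (pairingDl s).
have p0r s' : pairing s' 0 = 0 by apply: additive0 (pairingDr s').
rewrite /factor_gen; case: l => /=; case: insubP => [j _ Ej|_] /=;
  rewrite ?p0l ?p0r //.
- rewrite !tmap_pure !pairingE; congr (_ * _).
  by rewrite -[LHS]/(e ((hchi F m (hpi F j) : hecke F m) *: u)) hchi_hpi.
- rewrite !tmap_pure !pairingE; congr (_ * _).
  by rewrite -[LHS]/(d ((hchi F n (hpi F j) : hecke F n) *: w)) hchi_hpi.
Qed.

End Pairing.

(** The dual basis form of finite projectivity, which is what makes N^* (x) M^*
    the dual of M (x) N. *)
Definition dual_basis (F : comNzRingType) (k : nat) (M : lmodType (hecke F k))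
    (I : finType) (b : I -> M) (d : I -> dual (hchi F k) M) : Prop :=
  forall v, v = \sum_i (d i v)%:A *: b i.

Section Coevaluation.
Variables (F : comNzRingType) (m n : nat).
Variables (M : lmodType (hecke F m)) (N : lmodType (hecke F n)).
Local Notation T := (tens (vspaceof M) (vspaceof N)).
Local Notation DM := (dual (hchi F m) M).
Local Notation DN := (dual (hchi F n) N).
Local Notation T' := (tens (vspaceof (chi_twist N)) (vspaceof (chi_twist M))).
Variables (I J : finType) (bM : I -> M) (dM : I -> DM).
Variables (bN : J -> N) (dN : J -> DN).
Hypotheses (dMP : dual_basis bM dM) (dNP : dual_basis bN dN).

(** The inverse of the map given by the pairing. *)
Definition coeval (f : T -> F) : T' :=
  \sum_i \sum_j f (tpure (bM i : vspaceof M) (bN j : vspaceof N)) *: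
    tpure (dN j : vspaceof (chi_twist N)) (dM i : vspaceof (chi_twist M)).

Lemma coeval_ext f g : f =1 g -> coeval f = coeval g.
Proof. by move=> fg; do 2![apply: eq_bigr => ? _]; rewrite fg. Qed.
Lemma coevalD f g : coeval (fun t => f t + g t) = coeval f + coeval g.
Proof.
rewrite -big_split; apply: eq_bigr => i _ /=; rewrite -big_split.
by apply: eq_bigr => j _; rewrite scalerDl.
Qed.
Lemma coevalZ c f : coeval (fun t => c * f t) = c *: coeval f.
Proof.
rewrite scaler_sumr; apply: eq_bigr => i _; rewrite scaler_sumr.
by apply: eq_bigr => j _; rewrite scalerA.
Qed.

Lemma pairing_coeval (f : T -> F) t :
  {morph f : s t / s + t} -> (forall c t, f (c *: t) = c * f t) ->
  pairing (coeval f) t = f t.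
Proof.
move=> fD fZ.
move: t; apply: tens_ext => [s t|s t|u w]; rewrite ?pairingDr ?fD //.
have Euw : tpure u w = \sum_i \sum_j (dM i u * dN j w) *:
    tpure (bM i : vspaceof M) (bN j : vspaceof N) :> T.
  rewrite [in LHS](dMP u) (additive_sum _ _ (tpureDl w)); apply: eq_bigr => i _.
  rewrite [in LHS](dNP w) (additive_sum _ _ (tpureDr _)); apply: eq_bigr => j _.
  rewrite -[X in tpure X _]/((dM i u) *: (bM i : vspaceof M)).
  rewrite -[X in tpure _ X]/((dN j w) *: (bN j : vspaceof N)).
  by rewrite -tpure_bal -!tens_scale_pure scalerA mulrC.
rewrite [in RHS]Euw (additive_sum _ _ fD) (additive_sum _ _ (pairingDl _)).
apply: eq_bigr => i _.
rewrite (additive_sum _ _ fD) (additive_sum _ _ (pairingDl _)).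
by apply: eq_bigr => j _; rewrite pairingZl pairingE fZ mulrC.
Qed.

Lemma dual_expansion k (V : lmodType (hecke F k)) (K : finType) (b : K -> V)
    (d : K -> dual (hchi F k) V) (e : dual (hchi F k) V) :
  dual_basis b d ->
  (e : vspaceof (chi_twist V))
    = \sum_i e (b i) *: (d i : vspaceof (chi_twist V)).
Proof.
move=> bdP; apply: (@dual_ext _ _ _ (hchi F k) V) => v.
pose ev (x : vspaceof (chi_twist V)) : F := (x : dual (hchi F k) V) v.
have evD : {morph ev : x y / x + y} by [].
rewrite -[RHS]/(ev _) (additive_sum _ _ evD) [in LHS](bdP v).
rewrite (additive_sum _ _ (dualD e)); apply: eq_bigr => i _.
by rewrite /ev chi_scalar dual_scalar mulrC.
Qed.

Lemma coeval_pairing t' : coeval (pairing t') = t'.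
Proof.
move: t'; apply: tens_ext => [r s|r s //|d e].
  by rewrite -coevalD; apply: coeval_ext => t; rewrite pairingDl.
rewrite [in RHS](dual_expansion e dMP) (additive_sum _ _ (tpureDr _)).
apply: eq_bigr => i _; rewrite [in RHS](dual_expansion d dNP).
rewrite (additive_sum _ _ (tpureDl _)); apply: eq_bigr => j _.
by rewrite pairingE -tpure_bal -!tens_scale_pure scalerA.
Qed.

(** Since pairing with t' is inverse to coeval, this is the adjunction
    [pairing_factor_gen] read backwards. *)
Lemma coeval_factor_gen l r (f : T -> F) :
  {morph f : s t / s + t} -> (forall c t, f (c *: t) = c * f t) ->
  coeval (fun t => f (factor_gen M N l r t))
    = factor_gen (chi_twist N) (chi_twist M) (~~ l) r (coeval f).
Proof.
move=> fD fZ; rewrite -[RHS]coeval_pairing; apply: coeval_ext => t.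
by rewrite pairing_factor_gen pairing_coeval.
Qed.

End Coevaluation.

(** * The top coefficient of an element of the induction product *)

Section TopCoefficient.
Variables (F : comNzRingType) (m n : nat).
Variables (M : lmodType (hecke F m)) (N : lmodType (hecke F n)).
Local Notation k := (m + n)%N.
Local Notation H := (hecke F k).
Local Notation T := (tens (vspaceof M) (vspaceof N)).
Local Notation z := (factor_gen M N).
Local Notation W := {ffun {set 'I_k} -> T}.
Local Notation bot := (seg k m).
Local Notation top := (~: seg k n).
Implicit Types (i : 'I_k.-1) (A D : {set 'I_k}) (t : T) (f : W).

Definition coind_rep : {rmorphism H -> endo W} :=
  hlift (@endo_scalarC F W)
    (coind_rel k (@factor_gen_idem F m n M N) (@factor_gen_braid F m n M N)
       (@factor_gen_comm F m n M N) (@factor_gen_cross F m n M N)).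

Lemma coind_rep_hpi i f : coind_rep (hpi F i) f = coind_fun z i f.
Proof. by rewrite /coind_rep /= hlift_hpi. Qed.

Lemma coind_repM x y f : coind_rep (x * y) f = coind_rep x (coind_rep y f).
Proof. by rewrite rmorphM. Qed.

Lemma coind_rep_scalar c f : coind_rep c%:A f = c *: f.
Proof.
rewrite /coind_rep /= hlift_scale.
by rewrite [hlift _ _ _](rmorph1 coind_rep) mulr1.
Qed.

(** Coinduced modules contain V as the functions supported on one coset; the
    lowest subset is the one for which the generators with i.+1 <> m act on V
    as in M (x) N ([embed_gen]). *)
Definition embed t : W := [ffun A : {set 'I_k} => if A == bot then t else 0].

Lemma embedD : {morph embed : s t / s + t}.
Proof.
by move=> s t; apply/ffunP => A; rewrite !ffunE; case: ifP; rewrite ?addr0.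
Qed.
Lemma embedZ c t : embed (c *: t) = c *: embed t.
Proof.
by apply/ffunP => A; rewrite !ffunE; case: ifP; rewrite ?scaler0.
Qed.

Lemma embed_gen i t : i.+1 != m ->
  coind_fun z i (embed t) = embed (mtens_gen M N i t).
Proof.
move=> im; have lt_i := ltn_ord i; apply/ffunP => A; rewrite !ffunE.
have [->|nbot] := eqVneq A bot.
  rewrite !inE /= (_ : (i.+1 < m)%N = (i < m)%N) ?eqxx; last by lia.
  rewrite mtens_gen_factor // nbelow_seg; last by lia.
  by case: ltnP => // lt_im; rewrite (minn_idPr _) //; lia.
rewrite linear0; case: ifP => // lh; case: ifP => // hiA.
case: eqP => // Esw; case/eqP: nbot; rewrite -[A](swK i) Esw; apply: sw_id.
by rewrite !inE /=; lia.
Qed.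

(** The map H (x)_B T -> T that picks the coefficient of the longest coset
    representative. *)
Definition top_coef : boxtimes k M N -> T :=
  blift (fun x t => coind_rep x (embed t) top).

Fact top_coef_balanced : bbalanced (fun x t => coind_rep x (embed t) top).
Proof.
split=> [t x y|x s t|x c t|x i t im].
- by rewrite rmorphD ffunE.
- by rewrite embedD linearD ffunE.
- by rewrite coind_repM coind_rep_scalar embedZ.
- by rewrite coind_repM coind_rep_hpi embed_gen.
Qed.

Lemma top_coef_pure x t : top_coef (bpure M N x t) = coind_rep x (embed t) top.
Proof. exact: blift_pure top_coef_balanced x t. Qed.
Lemma top_coefD : {morph top_coef : u v / u + v}.
Proof. exact: bliftD top_coef_balanced. Qed.

Lemma top_coef_scalar c y : top_coef (c%:A *: y) = c *: top_coef y.
Proof.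
move: y; apply: boxtimes_ext => [u v|u v|x t].
- by rewrite scalerDr top_coefD.
- by rewrite top_coefD scalerDr.
by rewrite bpure_act !top_coef_pure coind_repM coind_rep_scalar ffunE.
Qed.

(** On the highest subset {n, ..., m+n-1} the letters below n are outside, so
    pi_i with i < n acts through N, and through M otherwise. *)
Lemma top_coef_gen i y : i.+1 != n ->
  top_coef (hpi F i *: y)
    = z (~~ (i < n)%N) (if (i < n)%N then i : nat else (i - n)%N) (top_coef y).
Proof.
move=> i_n; have lt_i := ltn_ord i; move: y.
apply: boxtimes_ext => [u v|u v|x t].
- by rewrite scalerDr top_coefD.
- by rewrite top_coefD linearD.
rewrite bpure_act !top_coef_pure coind_repM coind_rep_hpi.
rewrite ffunE !inE /= (_ : (i.+1 < n)%N = (i < n)%N) ?eqxx; last by lia.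
rewrite nbelow_setC negbK nbelow_seg; last by lia.
by case: ltnP => // lt_in; rewrite (minn_idPl _) //; lia.
Qed.


Local Notation p := (coset_elt (@hpi F k)).

(** Each generator moves the support of a function up by at most one in weight.
    Hence p_A, a product of as many generators as the weight of A exceeds the
    lowest one, carries the support to A, but to no subset of larger weight. *)
Lemma coind_rep_coset A : #|A| = m -> forall D t,
  (coind_rep (p A) (embed t) A = t) /\
  ((weight A < weight D)%N -> coind_rep (p A) (embed t) D = 0).
Proof.
have [_ hb hc] := hpi_rel F k.
move: A; apply: subset_ind => [|A i Am loA hiA IHA] D t.
  rewrite coset_elt_seg rmorph1; split=> [|lt_D]; first by rewrite ffunE eqxx.
  by rewrite ffunE; case: eqP lt_D => // ->; rewrite ltnn.
rewrite -(coset_elt_ascent hc loA hiA) coind_repM coind_rep_hpi.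
rewrite !ffunE mem_sw_lo mem_sw_hi (negbTE hiA) loA /= swK.
split=> [|lt_D]; first by case: (IHA A t).
have wA : weight (sw i A) = (weight A).+1.
  by rewrite (@weight_sw _ i (sw i A)) ?swK ?mem_sw_lo ?mem_sw_hi.
have -> : coind_rep (p A) (embed t) D = 0 by apply: (proj2 (IHA D t)); lia.
rewrite linear0; case: ifP => // lhD; case: ifP => // hiD.
have loD : lo i \notin D by move: lhD; rewrite hiD; case: (lo i \in D).
apply: (proj2 (IHA _ t)); have := weight_sw loD hiD; lia.
Qed.

Lemma top_coef_coset A t : #|A| = m ->
  top_coef (bpure M N (p A) t) = if A == top then t else 0.
Proof.
move=> Am; rewrite top_coef_pure; case: eqP => [EA|nEA].
  by rewrite -EA; apply: (proj1 (coind_rep_coset Am A t)).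
apply: (proj2 (coind_rep_coset Am _ t)).
have [|//] : A = top \/ (weight A < weight top)%N.
  by apply: weight_max; rewrite cardsCs setCK card_ord Am; lia.
by [].
Qed.

Local Notation q := (fun A => coset_elt (@hpibar F k) (~: A)).

Lemma hpibar_braid (i j : 'I_k.-1) : j = i.+1 :> nat ->
  hpibar F i * hpibar F j * hpibar F i = hpibar F j * hpibar F i * hpibar F j.
Proof.
have [_ tb _] := htheta_rel F k; move=> /tb; rewrite !(mulrN, mulNr) !opprK.
exact: oppr_inj.
Qed.
Lemma hpibar_comm (i j : 'I_k.-1) : (i.+1 < j)%N ->
  hpibar F i * hpibar F j = hpibar F j * hpibar F i.
Proof.
by have [_ _ tc] := htheta_rel F k; move=> /tc; rewrite !(mulrN, mulNr) !opprK.
Qed.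

Lemma hchi_hpibar i : (hchi F k (hpibar F i) : H) = hpibar F i.
Proof. by rewrite rmorphB rmorph1 /= hchi_hpi. Qed.

Lemma top_coefB (c x y : H) t :
  top_coef (c *: bpure M N (x - y) t)
    = top_coef (c *: bpure M N x t) - top_coef (c *: bpure M N y t).
Proof.
apply: (addIr (top_coef (c *: bpure M N y t))).
by rewrite -top_coefD -scalerDr -bpureDl !subrK.
Qed.

Lemma hpi_coset_descent i A : lo i \notin A -> hi i \in A ->
  hpi F i * p A = p A.
Proof.
have [hi_ _ hc] := hpi_rel F k.
by move=> loA hiA; rewrite (coset_elt_descent hc loA hiA) mulrA hi_.
Qed.

(** Induction downwards on A.  If i is in A and i.+1 is not, then chi(q_A) is
    chi(q_(s_i A)) (pi_i - 1), and the last factor meets p_D: it kills p_D if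
    i is a descent of D, replaces it by p_(s_i D) - p_D if D contains i but
    not i.+1, and otherwise replaces it by p_D (pi_j - 1) for some j. *)
Lemma top_coef_dual A D t : #|A| = m -> #|D| = m ->
  top_coef ((hchi F k (q A) : H) *: bpure M N (p D) t)
    = if D == A then t else 0.
Proof.
have [hi_ hb hc] := hpi_rel F k.
move=> /card_setC_ord An.
move: A An D t; apply: subset_ind_co => [|A i An loA hiA IHA] D t Dm.
  by rewrite setCK coset_elt_seg rmorph1 scale1r top_coef_coset.
rewrite -sw_setC -(coset_elt_ascent hpibar_comm) ?inE ?loA ?hiA //.
rewrite rmorphM.
rewrite -[X in top_coef (X *: _)]/(
  (hchi F k (q A) : H) * hchi F k (hpibar F i)).
rewrite hchi_hpibar -scalerA bpure_act mulrBl mul1r top_coefB (IHA D) //.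
have neq_A : ((lo i \in D) || (hi i \notin D)) -> (D == A) = false.
  by case: eqP => // ->; rewrite hiA (negbTE loA).
have neq_swA : ((lo i \notin D) || (hi i \in D)) -> (D == sw i A) = false.
  by case: eqP => // ->; rewrite mem_sw_lo mem_sw_hi hiA (negbTE loA).
have flat b : (lo i \in D) = b -> (hi i \in D) = b ->
    top_coef ((hchi F k (q A) : H) *: bpure M N (hpi F i * p D) t) = 0.
  move=> loD hiD; have [j [_ _ jm ->]] := coset_elt_flat hb hc Dm loD hiD.
  by rewrite bpure_gen // IHA // neq_A // loD hiD orbN.
case loD: (lo i \in D) in neq_A neq_swA flat *;
  case hiD: (hi i \in D) in neq_A neq_swA flat *.
- by rewrite (flat true) // neq_A // neq_swA // subrr.
- rewrite (coset_elt_ascent hc) ?loD ?hiD // IHA ?card_sw // neq_A // subr0.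
  by rewrite -(inj_eq (@sw_inj _ i)) swK.
- rewrite hpi_coset_descent ?loD ?hiD // (IHA D) // neq_swA //.
  by rewrite subrr.
- by rewrite (flat false) // neq_A // neq_swA // subrr.
Qed.

(** The span of the p_A (x) t is stable under left multiplication and contains
    1 (x) t.  The statement is proved with an arbitrary factor h on the left,
    because f and g need not be H-linear. *)
Lemma boxtimes_coset_ext (G : zmodType) (f g : boxtimes k M N -> G) :
  {morph f : s t / s + t} -> {morph g : s t / s + t} ->
  (forall A t, #|A| = m -> f (bpure M N (p A) t) = g (bpure M N (p A) t)) ->
  f =1 g.
Proof.
move=> fD gD fg; apply: boxtimes_ext => // x.
have [_ hb hc] := hpi_rel F k.
suff: forall (A : {set 'I_k}) t, #|A| = m ->
    f (bpure M N (x * p A) t) = g (bpure M N (x * p A) t).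
  move=> fgx t; have := fgx bot t; rewrite coset_elt_seg mulr1; apply.
  by rewrite card_seg //; lia.
pose agree (h : H) := forall A t, #|A| = m ->
  f (bpure M N (h * p A) t) = g (bpure M N (h * p A) t).
suff: forall h, agree h -> agree (h * x).
  by move=> /(_ 1); rewrite mul1r; apply=> A t Am; rewrite mul1r; apply: fg.
elim/hecke_gen_ind: x => [c|i|x y Sx Sy|x y Sx Sy] h Sh A t Am.
- rewrite -mulrA (_ : c%:A * p A = p A * c%:A); last first.
    by rewrite mulr_algl mulr_algr.
  by rewrite mulrA bpure_scalar Sh.
- rewrite -mulrA; case loA: (lo i \in A); case hiA: (hi i \in A).
  + have [j [_ _ jm ->]] := coset_elt_flat hb hc Am loA hiA.
    by rewrite mulrA bpure_gen // Sh.
  + by rewrite (coset_elt_ascent hc) ?loA ?hiA // Sh ?card_sw.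
  + by rewrite hpi_coset_descent ?loA ?hiA // Sh.
  + have [j [_ _ jm ->]] := coset_elt_flat hb hc Am loA hiA.
    by rewrite mulrA bpure_gen // Sh.
- by rewrite mulrDr mulrDl !bpureDl fD gD Sx // Sy.
- by rewrite mulrA; apply: Sy => // *; apply: Sx.
Qed.

End TopCoefficient.

(** * Twisting by chi *)

Section Chi.
Variables (F : comNzRingType) (m n : nat).
Variables (M : lmodType (hecke F m)) (N : lmodType (hecke F n)).
Variables (I J : finType) (bM : I -> M) (dM : I -> dual (hchi F m) M).
Variables (bN : J -> N) (dN : J -> dual (hchi F n) N).
Hypotheses (dMP : dual_basis bM dM) (dNP : dual_basis bN dN).
Local Notation k := (m + n)%N.
Local Notation H := (hecke F k).
Local Notation T := (tens (vspaceof M) (vspaceof N)).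
Local Notation cM := (chi_twist M).
Local Notation cN := (chi_twist N).
Local Notation T' := (tens (vspaceof cN) (vspaceof cM)).
Local Notation X := (dual (hchi F k) (boxtimes k M N)).
Local Notation Y := (boxtimes k cN cM).
Local Notation p := (coset_elt (@hpi F k)).
Local Notation q := (fun A => coset_elt (@hpibar F k) (~: A)).
Implicit Types (i : 'I_k.-1) (A : {set 'I_k}) (t : T) (s : T') (f : X).

Fact top_functional_subproof s :
  linear ((fun y => pairing s (top_coef y)) : vspaceof (boxtimes k M N) -> F^o).
Proof.
move=> c u v; rewrite top_coefD pairingDr; congr (_ + _).
rewrite -[X in top_coef X]/(c%:A *: (u : boxtimes k M N)) top_coef_scalar.
by rewrite pairingZr.
Qed.
Definition top_functional s : X := Dual (hchi F k) (top_functional_subproof s).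

Lemma top_functionalE s y : top_functional s y = pairing s (top_coef y).
Proof. by []. Qed.

(** The map from the induced to the coinduced module; it is balanced because the
    top coefficient exchanges the factors. *)
Definition frobenius : Y -> X := blift (fun x s => x *: top_functional s).

Fact frobenius_balanced : bbalanced (fun x s => x *: top_functional s).
Proof.
split=> [s x y|x s s'|x c s|x i s i_n].
- by rewrite scalerDl.
- rewrite -scalerDr; congr (_ *: _); apply: dual_ext => y.
  by rewrite dual_addE !top_functionalE pairingDl.
- rewrite -scalerA; congr (_ *: _); apply: dual_ext => y.
  rewrite -[LHS]/(top_functional s ((hchi F k c%:A : H) *: y)).
  rewrite !top_functionalE linearZ rmorph1 top_coef_scalar.
  by rewrite pairingZr pairingZl.
rewrite -scalerA; congr (_ *: _); apply: dual_ext => y.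
rewrite -[LHS]/(top_functional s ((hchi F k (hpi F i) : H) *: y)) hchi_hpi.
rewrite !top_functionalE top_coef_gen // -pairing_factor_gen negbK.
by rewrite mtens_gen_factor.
Qed.

Lemma frobenius_pure x s : frobenius (bpure cN cM x s) = x *: top_functional s.
Proof. exact: blift_pure frobenius_balanced x s. Qed.
Lemma frobeniusD : {morph frobenius : u v / u + v}.
Proof. exact: bliftD frobenius_balanced. Qed.

Definition coset_coef A f : T' :=
  coeval bM dM bN dN (fun t => f (bpure M N (p A) t)).
Definition inv_frobenius f : Y :=
  \sum_(A : {set 'I_k} | #|A| == m) bpure cN cM (q A) (coset_coef A f).

Lemma coset_coefD A : {morph coset_coef A : f g / f + g}.
Proof. by move=> f g; apply: coevalD. Qed.

Lemma inv_frobeniusD : {morph inv_frobenius : f g / f + g}.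
Proof.
move=> f g; rewrite -big_split; apply: eq_bigr => A _.
by rewrite coset_coefD bpureDr.
Qed.

Lemma pairing_coset_coef A f t :
  pairing (coset_coef A f) t = f (bpure M N (p A) t).
Proof.
apply: (pairing_coeval dMP dNP) => [u v|c u]; first by rewrite bpureDr dualD.
by rewrite -bpure_scalar mulr_algr -mulr_algl -bpure_act dual_scalar.
Qed.

Lemma coset_coef_act i A f :
  coset_coef A (hpi F i *: f)
    = coeval bM dM bN dN (fun t => f (bpure M N (hpi F i * p A) t)).
Proof.
apply: coeval_ext => t.
rewrite -[LHS]/(f ((hchi F k (hpi F i) : H) *: bpure M N (p A) t)).
by rewrite hchi_hpi bpure_act.
Qed.

Lemma coset_term_flat i A b f : #|A| = m ->
  (lo i \in A) = b -> (hi i \in A) = b ->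
  bpure cN cM (q A) (coset_coef A (hpi F i *: f))
    = hpi F i *: bpure cN cM (q A) (coset_coef A f).
Proof.
have [_ hb hc] := hpi_rel F k.
move=> Am loA hiA; rewrite coset_coef_act bpure_act.
have [j [Ej bj jm Hj]] := coset_elt_flat hb hc Am loA hiA.
have An := card_setC_ord Am.
have loC : (lo i \in ~: A) = ~~ b by rewrite inE loA.
have hiC : (hi i \in ~: A) = ~~ b by rewrite inE hiA.
have [j' [Ej' bj' jn Hj']] :=
  coset_elt_flat (@hpibar_braid F m n) (@hpibar_comm F m n) An loC hiC.
have -> : hpi F i * q A = q A * hpi F j'.
  rewrite -[hpi F i](subrK 1) -[hpi F j'](subrK 1) mulrDl mulrDr mul1r mulr1.
  by congr (_ + _).
rewrite bpure_gen // mtens_gen_factor // -bj'.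
have -> : (if ~~ b then j' : nat else (j' - n)%N) = nbelow b A i.
  by rewrite Ej' nbelow_setC negbK; case: (b) => //=; lia.
rewrite -(coeval_factor_gen dMP dNP) => [|u v|c u]; first last.
- by rewrite -bpure_scalar mulr_algr -mulr_algl -bpure_act dual_scalar.
- by rewrite bpureDr dualD.
congr bpure; apply: coeval_ext => t.
rewrite Hj bpure_gen // mtens_gen_factor // -bj.
have -> // : (if b then j : nat else (j - m)%N) = nbelow b A i.
by rewrite Ej; case: (b) => //=; lia.
Qed.

Lemma coset_term_ascent i A f : lo i \in A -> hi i \notin A ->
  bpure cN cM (q A) (coset_coef A (hpi F i *: f))
    = bpure cN cM (q A) (coset_coef (sw i A) f).
Proof.
have [_ _ hc] := hpi_rel F k.
by move=> loA hiA; rewrite coset_coef_act (coset_elt_ascent hc).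
Qed.

Lemma coset_term_ascent0 i A f : lo i \in A -> hi i \notin A ->
  hpi F i *: bpure cN cM (q A) (coset_coef A f) = 0.
Proof.
have [hI _ hc] := hpi_rel F k.
move=> loA hiA; rewrite bpure_act.
rewrite (coset_elt_descent (@hpibar_comm F m n) (i := i)) ?inE ?loA //.
rewrite mulrA mulrBr hI mulr1 subrr mul0r.
exact: additive0 (bpureDl _).
Qed.

(** At a descent the term of A also produces the term of s_i A, which makes up
    for the vanishing of the latter in [coset_term_ascent0]. *)
Lemma coset_term_descent i A f : lo i \notin A -> hi i \in A ->
  hpi F i *: bpure cN cM (q A) (coset_coef A f)
    = bpure cN cM (q A) (coset_coef A (hpi F i *: f)) +
      bpure cN cM (q (sw i A)) (coset_coef (sw i A) (hpi F i *: f)).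
Proof.
move=> loA hiA; rewrite coset_coef_act hpi_coset_descent //.
rewrite coset_term_ascent ?mem_sw_lo ?mem_sw_hi // swK bpure_act.
rewrite -[X in X * _](subrK 1) mulrDl mul1r addrC bpureDl; congr (_ + _).
by rewrite -sw_setC -(coset_elt_ascent (@hpibar_comm F m n)) ?inE ?loA ?hiA.
Qed.

Lemma inv_frobenius_gen i f :
  inv_frobenius (hpi F i *: f) = hpi F i *: inv_frobenius f.
Proof.
rewrite scaler_sumr /inv_frobenius.
pose asc A := (lo i \in A) && (hi i \notin A).
pose desc A := (lo i \notin A) && (hi i \in A).
rewrite (bigID asc) [RHS](bigID asc) /=.
rewrite [X in _ = X + _]big1 ?add0r => [|A /and3P[_ loA hiA]]; last first.
  by rewrite coset_term_ascent0.
rewrite [X in _ + X = _](bigID desc) [RHS](bigID desc) /= addrA.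
congr (_ + _); last first.
  apply: eq_bigr => A /andP[/andP[/eqP Am nasc] ndesc].
  apply: (coset_term_flat f Am erefl); move: nasc ndesc; rewrite /asc /desc.
  by case: (lo i \in A) (hi i \in A) => -[].
(* Ascents and descents at i are exchanged by s_i; match them in pairs. *)
rewrite [in LHS](reindex_inj (@sw_inj _ i)) addrC.
rewrite [X in _ + X](eq_bigl (fun A => (#|A| == m) && ~~ asc A && desc A));
  last first.
  move=> A; rewrite card_sw /asc /desc mem_sw_lo mem_sw_hi.
  by case: (#|A| == m) (lo i \in A) (hi i \in A) => -[] [].
rewrite -big_split; apply: eq_bigr => A /andP[_ /andP[loA hiA]].
by rewrite [RHS]coset_term_descent.
Qed.

Lemma inv_frobenius_scalar c f :
  inv_frobenius (c%:A *: f) = c%:A *: inv_frobenius f.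
Proof.
rewrite scaler_sumr; apply: eq_bigr => A _.
rewrite bpure_act (_ : c%:A * _ = q A * c%:A); last first.
  by rewrite mulr_algl mulr_algr.
rewrite bpure_scalar -coevalZ; congr bpure; apply: coeval_ext => t.
rewrite -[LHS]/(f ((hchi F k c%:A : H) *: bpure M N (p A) t)).
by rewrite linearZ rmorph1 dual_scalar.
Qed.

Lemma inv_frobenius_act (c : H) f :
  inv_frobenius (c *: f) = c *: inv_frobenius f.
Proof.
elim/hecke_gen_ind: c f => [c|i|x y Hx Hy|x y Hx Hy] f.
- exact: inv_frobenius_scalar.
- exact: inv_frobenius_gen.
- by rewrite !scalerDl inv_frobeniusD Hx Hy.
- by rewrite -!scalerA Hx Hy.
Qed.

(** By linearity this is tested at 1 (x) s, where all the values f(p_A (x) -)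
    vanish but the one at the highest subset. *)
Lemma frobeniusK : cancel frobenius inv_frobenius.
Proof.
apply: boxtimes_ext => [u v|u v //|x s].
  by rewrite frobeniusD inv_frobeniusD.
rewrite frobenius_pure inv_frobenius_act -[x in RHS]mulr1 -bpure_act.
congr (_ *: _).
have card_top : #|~: seg k n| = m.
  by rewrite cardsCs setCK card_ord card_seg; lia.
rewrite /inv_frobenius (bigD1 (~: seg k n)) ?card_top //= setCK coset_elt_seg.
rewrite big1 => [|A /andP[/eqP Am nA]]; rewrite ?addr0.
  congr bpure; rewrite -[RHS](coeval_pairing dMP dNP); apply: coeval_ext => t.
  by rewrite top_functionalE top_coef_coset // eqxx.
rewrite (_ : coset_coef A _ = 0) ?(additive0 (bpureDr _)) //.
rewrite -[RHS](coeval_pairing dMP dNP); apply: coeval_ext => t.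
rewrite top_functionalE top_coef_coset // (negbTE nA).
by rewrite (additive0 (pairingDr _)) (additive0 (pairingDl _)).
Qed.

(** Both functionals are compared at p_D (x) t; by duality of p and q only the
    term of A = D contributes. *)
Lemma inv_frobeniusK : cancel inv_frobenius frobenius.
Proof.
move=> f; apply: dual_ext; apply: boxtimes_coset_ext => [u v|u v|D t Dm].
- by rewrite dualD.
- by rewrite dualD.
pose ev (g : X) : F := g (bpure M N (p D) t).
have evD : {morph ev : g h / g + h} by [].
rewrite -[LHS]/(ev _) (additive_sum _ _ frobeniusD) (additive_sum _ _ evD).
rewrite (bigD1 D) ?Dm //= big1 ?addr0 => [|A /andP[/eqP Am nA]].
  rewrite frobenius_pure /ev.
  rewrite -[LHS]/(top_functional (coset_coef D f)
    ((hchi F k (q D) : H) *: bpure M N (p D) t)).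
  by rewrite top_functionalE top_coef_dual // eqxx pairing_coset_coef.
rewrite frobenius_pure /ev.
rewrite -[LHS]/(top_functional (coset_coef A f)
  ((hchi F k (q A) : H) *: bpure M N (p D) t)).
rewrite top_functionalE top_coef_dual // eq_sym (negbTE nA).
exact: additive0 (pairingDr _).
Qed.

Lemma boxtimes_chi_dual_basis : mod_iso (chi_twist (boxtimes k M N)) Y.
Proof.
apply: (@mod_iso_of_cancel _ (chi_twist (boxtimes k M N)) Y
  inv_frobenius frobenius).
- by move=> c u v; rewrite inv_frobeniusD inv_frobenius_act.
- exact: inv_frobeniusK.
- exact: frobeniusK.
Qed.

End Chi.

(** * Weak Bruhat interval modules, and restrictions *)

(** The coordinates in the interval basis are linear because they are unique. *)
Lemma interval_dual_basis (F : comNzRingType) (k : nat)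
    (M : lmodType (hecke F k)) :
  weak_bruhat_interval_module M ->
  exists (I : finType) (b : I -> M) (d : I -> dual (hchi F k) M),
    dual_basis b d.
Proof.
move=> [s [t [b [bP _]]]]; pose I := {g : 'S_k | g \in intvL s t} : finType.
have {}bP v : {c : {ffun I -> F} | v = \sum_g (c g)%:A *: b (val g) &
    forall c' : {ffun I -> F}, v = \sum_g (c' g)%:A *: b (val g) -> c = c'}.
  apply: cid2; have [c [cP cU]] := bP v.
  by exists c.
pose co v := s2val (bP v).
have coE v : v = \sum_g (co v g)%:A *: b (val g) by rewrite /co; case: (bP v).
have coU v (c : {ffun I -> F}) : v = \sum_g (c g)%:A *: b (val g) -> co v = c.
  by rewrite /co; case: (bP v) => c' _ cU /= /cU.
have co_lin g : linear ((fun v => co v g) : vspaceof M -> F^o).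
  move=> c u v; rewrite -[c *: u]/(c%:A *: (u : M)).
  rewrite (coU _ [ffun h : I => c * co u h + co v h]) ?ffunE //.
  rewrite {1}(coE u) {1}(coE v) scaler_sumr -big_split; apply: eq_bigr => h _.
  rewrite ffunE [RHS](_ : _ = c%:A *: ((co u h)%:A *: b (val h))
    + (co v h)%:A *: b (val h)) //.
  by rewrite !scalerDl [in RHS]scalerA mulr_algl scalerA.
exists I, (fun g => b (val g)), (fun g => Dual (hchi F k) (co_lin g)).
exact: coE.
Qed.

Lemma boxtimes_chi (F : comNzRingType) (m n : nat)
    (M : lmodType (hecke F m)) (N : lmodType (hecke F n)) :
  weak_bruhat_interval_module M -> weak_bruhat_interval_module N ->
  mod_iso (chi_twist (boxtimes (m + n) M N))
          (boxtimes (m + n) (chi_twist N) (chi_twist M)).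
Proof.
move=> /interval_dual_basis[I [bM [dM dMP]]].
move=> /interval_dual_basis[J [bN [dN dNP]]].
exact: boxtimes_chi_dual_basis dMP dNP.
Qed.

Lemma restr_phi (F : comNzRingType) (m n : nat)
    (L : lmodType (hecke F (m + n))) :
  mod_iso (parab_phi_twist (restr n L)) (restr m (phi_twist L)).
Proof.
by apply: (@mod_iso_of_cancel _
  (parab_phi_twist (restr n L)) (restr m (phi_twist L)) id id).
Qed.

Lemma restr_theta (F : comNzRingType) (k a : nat) (L : lmodType (hecke F k)) :
  mod_iso (parab_theta_twist (restr a L)) (restr a (theta_twist L)).
Proof.
by apply: (@mod_iso_of_cancel _
  (parab_theta_twist (restr a L)) (restr a (theta_twist L)) id id).
Qed.

Lemma restr_chi (F : comNzRingType) (k a : nat) (L : lmodType (hecke F k)) :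
  mod_iso (parab_chi_twist (restr a L)) (restr a (chi_twist L)).
Proof.
pose f (d : dual (parab_chi F k a) (restr a L)) : dual (hchi F k) L :=
  @Dual F _ _ (hchi F k) L (dual_fun d) (dualP d).
pose g (d : dual (hchi F k) L) : dual (parab_chi F k a) (restr a L) :=
  @Dual F _ _ (parab_chi F k a) (restr a L) (dual_fun d) (dualP d).
apply: (@mod_iso_of_cancel _
  (parab_chi_twist (restr a L)) (restr a (chi_twist L)) f g).
- by move=> c u v; apply: dual_ext.
- by move=> d; apply: dual_ext.
- by move=> d; apply: dual_ext.
Qed.

Theorem corollary3p18 (R : realType) (m n : nat)
    (M : lmodType (hecke R[i] m)) (N : lmodType (hecke R[i] n))
    (L : lmodType (hecke R[i] (m + n)))
    (hM : weak_bruhat_interval_module M)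
    (hN : weak_bruhat_interval_module N)
    (hL : weak_bruhat_interval_module L) :
  (* (A1) *)
  mod_iso (phi_twist (boxtimes (m + n) M N))
          (boxtimes (m + n) (phi_twist N) (phi_twist M)) /\
  (* (A2) *)
  mod_iso (theta_twist (boxtimes (m + n) M N))
          (boxtimes (m + n) (theta_twist M) (theta_twist N)) /\
  (* (A3) *)
  mod_iso (chi_twist (boxtimes (m + n) M N))
          (boxtimes (m + n) (chi_twist N) (chi_twist M)) /\
  (* (B1) *)
  mod_iso (parab_phi_twist (restr n L)) (restr m (phi_twist L)) /\
  (* (B2) *)
  mod_iso (parab_theta_twist (restr m L)) (restr m (theta_twist L)) /\
  (* (B3) *)
  mod_iso (parab_chi_twist (restr m L)) (restr m (chi_twist L)).
Proof.
split; first exact: boxtimes_phi.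
split; first exact: boxtimes_theta.
split; first exact: boxtimes_chi.
split; first exact: restr_phi.
split; first exact: restr_theta.
exact: restr_chi.
Qed.
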